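(* Let $(\mathcal C,\wedge,\vee,S)$ be a symmetric monoidal category with finite colimits and a zero object $0$, in which for every finite set $I$ and all objects $A_i$ ($i\in I$), $B$ the canonical morphism $\bigvee_{i\in I}(A_i\wedge B)\to(\bigvee_{i\in I}A_i)\wedge B$ is an isomorphism. Let $P\in\mathrm{Ob}\,\mathcal C$, let $E$ be a ring object (monoid) in the category of symmetric sequences $\mathcal C^\Sigma$, and let $\mathcal B$ be a full subcategory of $\mathcal C$ closed under the monoidal product. Then $\mathcal B$ can be enriched over the closed symmetric monoidal category $Sets_*^\Sigma$ of symmetric sequences of pointed sets. Namely, the $Sets_*^\Sigma$-objects of morphisms are defined by $$(\mathrm{Corr}^E_0(X,Y),\mathrm{Corr}^E_1(X,Y),\mathrm{Corr}^E_2(X,Y),\ldots),\qquad X,Y\in\mathcal B,$$ and compositions are defined by the pairings $\phi_{X,Y,Z}$ (both defined in the context). Denote the resulting $Sets_*^\Sigma$-category by $\mathrm{Corr}^E_*(\mathcal B)$. Moreover, if $E$ is a commutative ring object, then $\mathrm{Corr}^E_*(\mathcal B)$ is symmetric monoidal, where the monoidal product of $X,Y\in\mathrm{Ob}(\mathrm{Corr}^E_*(\mathcal B))$ is defined as $X\wedge Y$, with $\wedge$ the monoidal product in $\mathcal B$.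
   Context: A symmetric sequence in $\mathcal C$ is a sequence $(X_n)_{n\ge0}$ of objects of $\mathcal C$ with a left $\Sigma_n$-action on $X_n$. The category $\mathcal C^\Sigma$ is symmetric monoidal with $(X\wedge Y)_n=\bigvee_{p+q=n}\Sigma_n\times_{\Sigma_p\times\Sigma_q}(X_p\wedge Y_q)$, unit $(S,0,0,\ldots)$, and twist sending the summand $(\alpha,X_p\wedge Y_q)$ to $(\alpha\chi_{q,p},Y_q\wedge X_p)$, where $\chi_{q,p}(i)=i+p$ for $1\le i\le q$ and $\chi_{q,p}(i)=i-q$ for $q<i\le p+q$. $Sets_*^\Sigma$ is the same construction for pointed sets with smash product. A ring object $E$ in $\mathcal C^\Sigma$ amounts to $\Sigma_n$-objects $E_n$, $\Sigma_n\times\Sigma_m$-equivariant maps $\mu_{n,m}:E_n\wedge E_m\to E_{n+m}$ and a unit map $\iota_0:S\to E_0$, associative and unital in the usual sense. It is commutative if $\mu_{m,n}\circ twist=\chi_{n,m}\circ\mu_{n,m}:E_n\wedge E_m\to E_{m+n}$ for all $n,m$. For $X,Y\in\mathcal B$ and $n\ge 0$, $\mathrm{Corr}^E_n(X,Y):=\mathrm{Hom}_{\mathcal C}(X\wedge P^{\wedge n},Y\wedge E_n)$, pointed at the zero map (for $n=0$ it is $\mathrm{Hom}_{\mathcal C}(X,Y\wedge E_0)$). $\tau\in\Sigma_n$ acts by conjugation: $\tau\cdot f=(Y\wedge\tau)\circ f\circ(X\wedge\tau^{-1})$, where $\Sigma_n$ permutes the factors of $P^{\wedge n}$. The pairing $\phi_{X,Y,Z}:\mathrm{Corr}^E_n(X,Y)\wedge\mathrm{Corr}^E_m(Y,Z)\to\mathrm{Corr}^E_{n+m}(X,Z)$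 sends $(f,g)$ to the composite $$X\wedge P^{\wedge n}\wedge P^{\wedge m}\xrightarrow{f\wedge P^{\wedge m}}Y\wedge E_n\wedge P^{\wedge m}\cong Y\wedge P^{\wedge m}\wedge E_n\xrightarrow{g\wedge E_n}Z\wedge E_m\wedge E_n\cong Z\wedge E_n\wedge E_m\xrightarrow{Z\wedge\mu_{n,m}}Z\wedge E_{n+m},$$ the isomorphisms being symmetry isomorphisms of $\mathcal C$. The identity of $X$ is $X\cong X\wedge S\xrightarrow{\mathrm{id}\wedge\iota_0}X\wedge E_0$.
   Formalization: For the symmetric monoidal claim, the full subcategory B is also assumed to contain the unit S; with closure under the monoidal product alone the claim fails, e.g. for B empty, where there is no unit object. *)

(* Defs.v *)
From HB Require Import structures.
From mathcomp Require Import all_boot all_fingroup.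
From mathcomp Require Import zify.
From mathcomp Require Import boolp.
From Stdlib Require Import Relation_Operators.

Set Implicit Arguments.
Unset Strict Implicit.
Unset Printing Implicit Defensive.

#[local] Obligation Tactic := cbv beta.

(** * Permutations

Permutations in ['S_n] are composed in diagrammatic order: [s * t] is [s]
followed by [t], that is, the usual product of [t] by [s].  Indices start
from [0]. *)

Local Open Scope group_scope.

Section BlockPerm.
Variables (p q : nat) (s : 'S_p) (t : 'S_q).

Definition psum_fun (i : 'I_(p + q)) : 'I_(p + q) :=
  match split i with
  | inl j => lshift q (s j)
  | inr j => rshift p (t j)
  end.

Lemma psum_fun_inj : injective psum_fun.
Proof.
move=> i j; rewrite /psum_fun -{2}[i]splitK -{2}[j]splitK /unsplit.
case: (split i) => a; case: (split j) => b /(congr1 (@nat_of_ord _)) /=.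
- by move/val_inj/perm_inj ->.
- by move=> E; have := ltn_ord (s a); rewrite E ltnNge leq_addr.
- by move=> E; have := ltn_ord (s b); rewrite -E ltnNge leq_addr.
- by move/addnI/val_inj/perm_inj ->.
Qed.

(* The image of (s, t) under the inclusion of S_p x S_q into S_(p + q). *)
Definition psum : 'S_(p + q) := perm psum_fun_inj.

End BlockPerm.

Section Chi.
Variables q p : nat.

Lemma chi_subproof (i : 'I_(q + p)) : (if i < q then i + p else i - q) < q + p.
Proof. by have := ltn_ord i; case: (ltnP i q); lia. Qed.

Definition chi_fun (i : 'I_(q + p)) : 'I_(q + p) := Ordinal (chi_subproof i).

Lemma chi_fun_inj : injective chi_fun.
Proof.
move=> i j /(congr1 (@nat_of_ord _)) /= E; apply: val_inj => /=.
have := ltn_ord i; have := ltn_ord j; move: E.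
by case: (ltnP i q); case: (ltnP j q); lia.
Qed.

Definition chi : 'S_(q + p) := perm chi_fun_inj.

End Chi.

Section PermTail.
Variables (n : nat) (s : 'S_n.+1).

(* [unlift] never returns [None] here, see [perm_tailP]. *)
Definition perm_tail_fun (i : 'I_n) : 'I_n :=
  odflt i (unlift (s ord0) (s (lift ord0 i))).

Lemma perm_tail_funP (i : 'I_n) :
  s (lift ord0 i) = lift (s ord0) (perm_tail_fun i).
Proof.
rewrite /perm_tail_fun; case: unliftP => [j ->//|].
by move/perm_inj => E; have := neq_lift ord0 i; rewrite E eqxx.
Qed.

Lemma perm_tail_inj : injective perm_tail_fun.
Proof.
move=> i j E; apply/(@lift_inj _ ord0)/(@perm_inj _ s).
by rewrite !perm_tail_funP E.
Qed.

Definition perm_tail : 'S_n := perm perm_tail_inj.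

Lemma perm_tailP : s = lift_perm ord0 (s ord0) perm_tail.
Proof.
apply/permP => i; case: (unliftP ord0 i) => [j ->|->].
  by rewrite lift_perm_lift permE perm_tail_funP.
by rewrite lift_perm_id.
Qed.

End PermTail.

(* A permutation seen as a map on nat, the identity out of ['I_n]; equalities
   of permutations reduce to arithmetic through [pval_inj]. *)
Section PermVal.

Definition pval n (s : 'S_n) (i : nat) : nat :=
  if insub i is Some j then nat_of_ord (s j) else i.

Lemma pval_ord n (s : 'S_n) (i : 'I_n) : pval s i = s i.
Proof. by rewrite /pval valK. Qed.

Lemma pval_out n (s : 'S_n) i : n <= i -> pval s i = i.
Proof. by move=> h; rewrite /pval insubF // ltnNge h. Qed.

Lemma pval_lt n (s : 'S_n) i : (pval s i < n) = (i < n).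
Proof.
case: (ltnP i n) => h; last by rewrite pval_out // ltnNge h.
by rewrite (pval_ord s (Ordinal h)) ltn_ord.
Qed.

Lemma pval_inj n (s t : 'S_n) : pval s =1 pval t -> s = t.
Proof. by move=> E; apply/permP => i; apply: val_inj; rewrite /= -!pval_ord. Qed.

Lemma pval1 n i : pval (1 : 'S_n) i = i.
Proof.
case: (ltnP i n) => h; last by rewrite pval_out.
by rewrite (pval_ord _ (Ordinal h)) perm1.
Qed.

Lemma pvalM n (s t : 'S_n) i : pval (s * t) i = pval t (pval s i).
Proof.
case: (ltnP i n) => h; last by rewrite !pval_out.
by rewrite !(pval_ord _ (Ordinal h)) permM pval_ord.
Qed.

Lemma pval_cast m n (e : m = n) s i : pval (cast_perm e s) i = pval s i.
Proof. by case: n / e; rewrite cast_perm_id. Qed.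

Lemma pval_psum p q (s : 'S_p) (t : 'S_q) i :
  pval (psum s t) i = if i < p then pval s i else p + pval t (i - p).
Proof.
case: (ltnP i (p + q)) => h; last first.
  have hp : (i < p) = false by lia.
  by rewrite hp !pval_out; lia.
rewrite (pval_ord _ (Ordinal h)) permE /psum_fun.
case: splitP => j /= E; rewrite E.
  by rewrite ltn_ord pval_ord.
by rewrite ltnNge leq_addr /= addKn pval_ord.
Qed.

Lemma pval_chi q p i :
  pval (chi q p) i =
  if i < q then i + p else if i < q + p then i - q else i.
Proof.
case: (ltnP i (q + p)) => h; last first.
  by rewrite pval_out //; case: ltnP; lia.
by rewrite (pval_ord _ (Ordinal h)) permE.
Qed.

End PermVal.

Definition pvalE := (pval1, pvalM, pval_cast, pval_psum, pval_chi).

Ltac case_ltn :=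
  repeat match goal with
  | |- context [if leq (S ?a) ?b then _ else _] =>
    lazymatch a with
    | context [if _ then _ else _] => fail
    | _ => case: (ltnP a b) => ?
    end
  end.

Lemma psum11 p q : psum (1 : 'S_p) (1 : 'S_q) = 1.
Proof. by apply: pval_inj => i; rewrite !pvalE; case: ltnP; lia. Qed.

Lemma psumM p q (s s' : 'S_p) (t t' : 'S_q) :
  psum s t * psum s' t' = psum (s * s') (t * t').
Proof.
apply: pval_inj => i; rewrite !pvalE; case: (ltnP i p) => h.
  by rewrite pval_lt h.
by rewrite ltnNge leq_addr /= addKn.
Qed.

(** * Categories *)

Declare Scope cat_scope.
Local Open Scope cat_scope.

Reserved Notation "g ∘ f" (at level 40, left associativity).
Reserved Notation "X ⊗ Y" (at level 38, left associativity).
Reserved Notation "f ⊠ g" (at level 38, left associativity).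

Record Cat := MkCat {
  Ob :> Type;
  Hom : Ob -> Ob -> Type;
  idm : forall X, Hom X X;
  compm : forall X Y Z, Hom Y Z -> Hom X Y -> Hom X Z;
  compmA : forall X Y Z W (h : Hom Z W) (g : Hom Y Z) (f : Hom X Y),
    compm h (compm g f) = compm (compm h g) f;
  comp1m : forall X Y (f : Hom X Y), compm (idm Y) f = f;
  compm1 : forall X Y (f : Hom X Y), compm f (idm X) = f
}.
Arguments idm {c} X.
Arguments Hom {c} X Y.

Notation "g ∘ f" := (compm g f) : cat_scope.

Definition are_inverse (C : Cat) (X Y : C) (f : Hom X Y) (g : Hom Y X) : Prop :=
  g ∘ f = idm X /\ f ∘ g = idm Y.

Definition is_iso (C : Cat) (X Y : C) (f : Hom X Y) : Prop :=
  exists g : Hom Y X, are_inverse f g.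

Record Functor (J C : Cat) := MkFunctor {
  fun_ob :> J -> C;
  fun_hom : forall i j, Hom i j -> Hom (fun_ob i) (fun_ob j);
  fun_id : forall i, fun_hom (idm i) = idm (fun_ob i);
  fun_comp : forall i j k (g : Hom j k) (f : Hom i j),
    fun_hom (g ∘ f) = fun_hom g ∘ fun_hom f
}.

Definition is_cocone (J C : Cat) (D : Functor J C) (L : C)
    (a : forall i, Hom (D i) L) : Prop :=
  forall i j (u : Hom i j), a j ∘ fun_hom D u = a i.

Definition is_colimit (J C : Cat) (D : Functor J C) (L : C)
    (a : forall i, Hom (D i) L) : Prop :=
  is_cocone a /\
  forall (M : C) (b : forall i, Hom (D i) M), is_cocone b ->
    exists! h : Hom L M, forall i, h ∘ a i = b i.

Definition finite_type (T : Type) : Prop :=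
  exists (n : nat) (f : 'I_n -> T), forall x, exists i, f i = x.

Definition finite_cat (J : Cat) : Prop :=
  finite_type J /\ forall i j : J, finite_type (Hom i j).

Definition has_finite_colimits (C : Cat) : Prop :=
  forall (J : Cat) (D : Functor J C), finite_cat J ->
    exists (L : C) (a : forall i, Hom (D i) L), is_colimit a.

Definition is_coproduct (C : Cat) (I : Type) (A : I -> C) (W : C)
    (a : forall i, Hom (A i) W) : Prop :=
  forall (M : C) (b : forall i, Hom (A i) M),
    exists! h : Hom W M, forall i, h ∘ a i = b i.

Record ZeroObject (C : Cat) := MkZeroObject {
  zob : C;
  zto : forall X, Hom X zob;
  zfrom : forall X, Hom zob X;
  zto_uniq : forall X (f : Hom X zob), f = zto X;
  zfrom_uniq : forall X (f : Hom zob X), f = zfrom X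
}.

Definition zero_map (C : Cat) (O : ZeroObject C) (X Y : C) : Hom X Y :=
  zfrom O Y ∘ zto O X.

Lemma zero_mapl (C : Cat) (O : ZeroObject C) (X Y Z : C) (f : Hom Y Z) :
  f ∘ zero_map O X Y = zero_map O X Z.
Proof. by rewrite /zero_map compmA (zfrom_uniq (f ∘ _)). Qed.

Lemma zero_mapr (C : Cat) (O : ZeroObject C) (X Y Z : C) (f : Hom X Y) :
  zero_map O Y Z ∘ f = zero_map O X Z.
Proof. by rewrite /zero_map -compmA (zto_uniq (zto O Y ∘ f)). Qed.

Record SymMonCat := MkSymMonCat {
  smc_cat :> Cat;
  tens : smc_cat -> smc_cat -> smc_cat;
  tensm : forall X X' Y Y' : smc_cat,
    Hom X X' -> Hom Y Y' -> Hom (tens X Y) (tens X' Y');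
  munit : smc_cat;
  massoc : forall X Y Z, Hom (tens (tens X Y) Z) (tens X (tens Y Z));
  massoc' : forall X Y Z, Hom (tens X (tens Y Z)) (tens (tens X Y) Z);
  lunit : forall X, Hom (tens munit X) X;
  lunit' : forall X, Hom X (tens munit X);
  runit : forall X, Hom (tens X munit) X;
  runit' : forall X, Hom X (tens X munit);
  msw : forall X Y, Hom (tens X Y) (tens Y X);
  tensm_id : forall X Y, tensm (idm X) (idm Y) = idm (tens X Y);
  tensm_comp : forall X X' X'' Y Y' Y'' (f' : Hom X' X'') (f : Hom X X')
      (g' : Hom Y' Y'') (g : Hom Y Y'),
    tensm (f' ∘ f) (g' ∘ g) = tensm f' g' ∘ tensm f g;
  massocK : forall X Y Z, are_inverse (massoc X Y Z) (massoc' X Y Z);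
  lunitK : forall X, are_inverse (lunit X) (lunit' X);
  runitK : forall X, are_inverse (runit X) (runit' X);
  mswK : forall X Y, are_inverse (msw X Y) (msw Y X);
  massoc_nat : forall X X' Y Y' Z Z'
      (f : Hom X X') (g : Hom Y Y') (h : Hom Z Z'),
    massoc X' Y' Z' ∘ tensm (tensm f g) h
    = tensm f (tensm g h) ∘ massoc X Y Z;
  lunit_nat : forall X X' (f : Hom X X'),
    lunit X' ∘ tensm (idm munit) f = f ∘ lunit X;
  runit_nat : forall X X' (f : Hom X X'),
    runit X' ∘ tensm f (idm munit) = f ∘ runit X;
  msw_nat : forall X X' Y Y' (f : Hom X X') (g : Hom Y Y'),
    msw X' Y' ∘ tensm f g = tensm g f ∘ msw X Y;
  triangle : forall X Y,
    tensm (idm X) (lunit Y) ∘ massoc X munit Y = tensm (runit X) (idm Y);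
  pentagon : forall X Y Z W,
    massoc X Y (tens Z W) ∘ massoc (tens X Y) Z W
    = tensm (idm X) (massoc Y Z W) ∘ massoc X (tens Y Z) W
      ∘ tensm (massoc X Y Z) (idm W);
  hexagon : forall X Y Z,
    massoc Y Z X ∘ msw X (tens Y Z) ∘ massoc X Y Z
    = tensm (idm Y) (msw X Z) ∘ massoc Y X Z ∘ tensm (msw X Y) (idm Z)
}.
Arguments munit {s}.
Arguments massoc {s} X Y Z.
Arguments massoc' {s} X Y Z.
Arguments lunit {s} X.
Arguments lunit' {s} X.
Arguments runit {s} X.
Arguments runit' {s} X.
Arguments msw {s} X Y.

Notation "X ⊗ Y" := (tens X Y) : cat_scope.
Notation "f ⊠ g" := (tensm f g) : cat_scope.

(* For all coproducts W of the A i and W' of the A i ⊗ B, the canonical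
   morphism W' -> W ⊗ B is invertible; I may be empty. *)
Definition tens_distributive (C : SymMonCat) : Prop :=
  forall (I : finType) (A : I -> C) (B W W' : C)
    (a : forall i, Hom (A i) W) (a' : forall i, Hom (A i ⊗ B) W')
    (c : Hom W' (W ⊗ B)),
    is_coproduct a -> is_coproduct a' ->
    (forall i, c ∘ a' i = a i ⊠ idm B) -> is_iso c.

Definition is_closed (V : SymMonCat) : Prop :=
  forall X Y : V, exists (H : V) (ev : Hom (H ⊗ X) Y),
    forall (W : V) (g : Hom (W ⊗ X) Y),
      exists! h : Hom W H, ev ∘ (h ⊠ idm X) = g.

(* Objects of the full subcategory on the objects satisfying [B]. *)
Definition full_ob (C : Cat) (B : C -> Prop) : Type := {X : C | B X}.

(** * Symmetric sequences *)

Record SymSeqData (C : Cat) := MkSymSeqData {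
  sqob :> nat -> C;
  sqact : forall n, 'S_n -> Hom (sqob n) (sqob n)
}.

(* A left action: [s * t] is the permutation "t after s". *)
Definition is_symseq (C : Cat) (D : SymSeqData C) : Prop :=
  (forall n, sqact D (1 : 'S_n) = idm (D n)) /\
  (forall n (s t : 'S_n), sqact D (s * t) = sqact D t ∘ sqact D s).

Record SymSeq (C : Cat) := MkSymSeq {
  sqdata :> SymSeqData C;
  sqlaws : is_symseq sqdata
}.

Section SymSeqCat.
Variable C : Cat.

Record sqhom (X Y : SymSeq C) := MkSqhom {
  sqh : forall n, Hom (X n) (Y n);
  sqh_eq : forall n (s : 'S_n), sqh n ∘ sqact X s = sqact Y s ∘ sqh n
}.

Lemma sqhom_eq X Y (f g : sqhom X Y) : (forall n, sqh f n = sqh g n) -> f = g.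
Proof.
case: f g => [f hf] [g hg] /= E.
have {}E : f = g by apply: functional_extensionality_dep.
by case: g / E hg => hg; congr MkSqhom; apply: Prop_irrelevance.
Qed.

Program Definition sqid (X : SymSeq C) : sqhom X X :=
  @MkSqhom X X (fun n => idm (X n)) _.
Next Obligation. by move=> X n s; rewrite comp1m compm1. Qed.

Program Definition sqcomp X Y Z (g : sqhom Y Z) (f : sqhom X Y) : sqhom X Z :=
  @MkSqhom X Z (fun n => sqh g n ∘ sqh f n) _.
Next Obligation.
by move=> X Y Z g f n s; rewrite -compmA sqh_eq compmA sqh_eq compmA.
Qed.

Program Definition SymSeqCat : Cat := @MkCat (SymSeq C) sqhom sqid sqcomp _ _ _.
Next Obligation. by move=> *; apply: sqhom_eq => n /=; rewrite compmA. Qed.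
Next Obligation. by move=> *; apply: sqhom_eq => n /=; rewrite comp1m. Qed.
Next Obligation. by move=> *; apply: sqhom_eq => n /=; rewrite compm1. Qed.

End SymSeqCat.

Definition sqcast (C : Cat) (D : nat -> C) m n (e : m = n) : Hom (D m) (D n) :=
  match e in _ = k return Hom (D m) (D k) with erefl => idm (D m) end.
Arguments sqcast {C} D {m n} e.

(** * Ring objects in symmetric sequences

A monoid for the product of symmetric sequences, given by the components
[E_n ⊗ E_m -> E_(n + m)] of its multiplication. *)

Record RingObject (C : SymMonCat) := MkRingObject {
  rseq :> SymSeq C;
  rmul : forall n m, Hom (rseq n ⊗ rseq m) (rseq (n + m));
  rone : Hom munit (rseq 0);
  rmul_eq : forall n m (s : 'S_n) (t : 'S_m),
    rmul n m ∘ (sqact rseq s ⊠ sqact rseq t)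
    = sqact rseq (psum s t) ∘ rmul n m;
  rmulA : forall n m k,
    rmul n (m + k) ∘ (idm (rseq n) ⊠ rmul m k) ∘ massoc _ _ _
    = sqcast rseq (esym (addnA n m k)) ∘ rmul (n + m) k
      ∘ (rmul n m ⊠ idm (rseq k));
  rmul1 : forall n, rmul 0 n ∘ (rone ⊠ idm (rseq n)) = lunit (rseq n);
  rmulr1 : forall n,
    sqcast rseq (addn0 n) ∘ rmul n 0 ∘ (idm (rseq n) ⊠ rone) = runit (rseq n)
}.

Definition ring_commutative (C : SymMonCat) (E : RingObject C) : Prop :=
  forall n m,
    rmul E m n ∘ msw (E n) (E m)
    = sqcast E (addnC n m) ∘ sqact E (chi n m) ∘ rmul E n m.

(** * Pointed sets *)

Record PSet := MkPSet { pcar :> Type; pt : pcar }.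
Arguments pt {p}.

Record pmap (X Y : PSet) := MkPmap {
  pfun :> X -> Y;
  pfun_pt : pfun pt = pt
}.

Lemma pmap_eq X Y (f g : pmap X Y) : f =1 g -> f = g.
Proof.
case: f g => [f hf] [g hg] /= /funext E.
by case: g / E hg => hg; congr MkPmap; apply: Prop_irrelevance.
Qed.

Program Definition pid (X : PSet) : pmap X X := @MkPmap X X id _.
Next Obligation. by []. Qed.

Program Definition pcomp X Y Z (g : pmap Y Z) (f : pmap X Y) : pmap X Z :=
  @MkPmap X Z (fun x => g (f x)) _.
Next Obligation. by move=> X Y Z g f; rewrite /= !pfun_pt. Qed.

Program Definition PSetCat : Cat := @MkCat PSet pmap pid pcomp _ _ _.
Next Obligation. by move=> *; apply: pmap_eq. Qed.
Next Obligation. by move=> *; apply: pmap_eq. Qed.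
Next Obligation. by move=> *; apply: pmap_eq. Qed.

(** * Quotients by the equivalence relation generated by a relation *)

Section Quotient.
Variables (T : Type) (R : T -> T -> Prop).

Definition quot : Type :=
  {A : T -> Prop | exists x, A = clos_refl_sym_trans T R x}.

Definition cls (x : T) : quot := exist _ _ (ex_intro _ x erefl).

Lemma cls_eq x y : R x y -> cls x = cls y.
Proof.
move=> h; apply: eq_exist => /=; apply/funext => z; apply/propext; split=> k.
  exact: (rst_trans _ _ _ _ _ (rst_sym _ _ _ _ (rst_step _ _ _ _ h)) k).
exact: (rst_trans _ _ _ _ _ (rst_step _ _ _ _ h) k).
Qed.

Lemma cls_surj u : exists x, u = cls x.
Proof. by case: u => A [x E]; exists x; apply: eq_exist. Qed.

(* Sealed, as unfolding would expose the choice of representatives. *)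
Lemma quot_lift_subproof U : {L : (T -> U) -> quot -> U |
  forall f x, (forall x y, R x y -> f x = f y) -> L f (cls x) = f x}.
Proof.
exists (fun f u => f (projT1 (cid (cls_surj u)))) => f x hf.
case: cid => y /= /(congr1 (@proj1_sig _ _)) /= E.
have : clos_refl_sym_trans T R x y by rewrite E; apply: rst_refl.
by elim=> // [a b /hf|a b c _ -> _].
Qed.

Definition quot_lift U : (T -> U) -> quot -> U := sval (quot_lift_subproof U).

Lemma quot_liftE U (f : T -> U) x :
  (forall x y, R x y -> f x = f y) -> quot_lift f (cls x) = f x.
Proof. exact: (svalP (quot_lift_subproof U)). Qed.

End Quotient.

(** * Symmetric sequences of pointed sets: elements *)

Notation SymPSet := (SymSeq PSetCat).

Definition el (X : SymPSet) (n : nat) : Type := pcar (X n).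
Definition ept (X : SymPSet) n : el X n := @pt (X n).
Arguments ept {X n}.
Definition sact (X : SymPSet) n (s : 'S_n) : el X n -> el X n :=
  pfun (sqact X s).
Arguments sact {X n} s x.
Definition ap (X Y : SymPSet) (f : sqhom X Y) n : el X n -> el Y n :=
  pfun (sqh f n).
Definition scast (X : SymPSet) m n (e : m = n) : el X m -> el X n :=
  pfun (sqcast X e).
Arguments scast {X m n} e x.

Section Elements.
Variables X Y Z : SymPSet.

Lemma sact1 n (x : el X n) : sact 1 x = x.
Proof. by rewrite /sact (sqlaws X).1. Qed.

Lemma sactM n (s t : 'S_n) (x : el X n) : sact (s * t) x = sact t (sact s x).
Proof. by rewrite /sact (sqlaws X).2. Qed.

Lemma sact_pt n (s : 'S_n) : sact s (ept : el X n) = ept.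
Proof. exact: pfun_pt. Qed.

Lemma ap_act (f : sqhom X Y) n (s : 'S_n) x : ap f (sact s x) = sact s (ap f x).
Proof. exact: (congr1 (fun g : pmap _ _ => g x) (sqh_eq f s)). Qed.

Lemma ap_pt (f : sqhom X Y) n : ap f (ept : el X n) = ept.
Proof. exact: pfun_pt. Qed.

Lemma sqhom_ext (f g : sqhom X Y) : (forall n x, @ap _ _ f n x = ap g x) -> f = g.
Proof. by move=> E; apply: sqhom_eq => n; apply: pmap_eq => x; apply: E. Qed.

Lemma scast_id n (e : n = n) (x : el X n) : scast e x = x.
Proof. by rewrite (eq_irrelevance e erefl). Qed.

Lemma scast_pt m n (e : m = n) : scast e (ept : el X m) = ept.
Proof. by case: n / e. Qed.

Lemma scast_comp m n k (e : m = n) (e' : n = k) (x : el X m) :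
  scast e' (scast e x) = scast (etrans e e') x.
Proof. by case: k / e'; rewrite scast_id. Qed.

Lemma scast_act m n (e : m = n) s (x : el X m) :
  scast e (sact s x) = sact (cast_perm e s) (scast e x).
Proof. by case: n / e; rewrite cast_perm_id. Qed.

Lemma ap_cast (f : sqhom X Y) m n (e : m = n) x :
  ap f (scast e x) = scast e (ap f x).
Proof. by case: n / e. Qed.

(* Equivariant families of pointed maps. *)
Program Definition mk_sqhom (f : forall n, el X n -> el Y n)
    (fpt : forall n, f n ept = ept)
    (fact : forall n s x, f n (sact s x) = sact s (f n x)) : sqhom X Y :=
  @MkSqhom _ X Y (fun n => @MkPmap _ _ (f n) (fpt n)) _.
Next Obligation. by move=> f fpt fact n s; apply: pmap_eq; exact: fact. Qed.

End Elements.

Lemma ap_id X n x : @ap X X (sqid X) n x = x. Proof. by []. Qed.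
Lemma ap_comp X Y Z (g : sqhom Y Z) (f : sqhom X Y) n x :
  @ap X Z (sqcomp g f) n x = ap g (ap f x).
Proof. by []. Qed.

Program Definition mk_sympset (ob : nat -> Type) (b : forall n, ob n)
    (act : forall n, 'S_n -> ob n -> ob n)
    (act_pt : forall n (s : 'S_n), act n s (b n) = b n)
    (act1 : forall n x, act n 1 x = x)
    (actM : forall n (s t : 'S_n) x, act n (s * t) x = act n t (act n s x)) :
    SymPSet :=
  @MkSymSeq PSetCat
    (@MkSymSeqData PSetCat (fun n => @MkPSet (ob n) (b n))
       (fun n s => @MkPmap (MkPSet (b n)) (MkPSet (b n)) (act n s) (act_pt n s)))
    _.
Next Obligation.
move=> ob b act act_pt act1 actM; split=> [n|n s t]; apply: pmap_eq.
  exact: act1.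
exact: actM.
Qed.

(** * The monoidal product of symmetric sequences of pointed sets

[(X ∧ Y)_n] is the wedge over [p + q = n] of the pointed sets
[Σ_n ×_(Σ_p × Σ_q) (X_p ∧ Y_q)]: the classes [[a; x, y]] with [a : 'S_n],
[x : X_p] and [y : Y_q], where [[a ∘ (s × t); x, y]] = [[a; s x, t y]] and
where all the classes with [x] or [y] the base point are identified. *)

Section Day.
Variables X Y : SymPSet.

Record day_gen (n : nat) := DayGen {
  dg_p : nat;
  dg_q : nat;
  dg_e : dg_p + dg_q = n;
  dg_a : 'S_n;
  dg_x : el X dg_p;
  dg_y : el Y dg_q
}.

Definition day_null n (g : day_gen n) : Prop :=
  dg_x g = ept \/ dg_y g = ept.

Inductive day_rel n : day_gen n -> day_gen n -> Prop :=
| DayInd p q (e : p + q = n) (a : 'S_n) (s : 'S_p) (t : 'S_q)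
    (x : el X p) (y : el Y q) :
    day_rel (DayGen e (cast_perm e (psum s t) * a) x y)
            (DayGen e a (sact s x) (sact t y))
| DayNull (g h : day_gen n) : day_null g -> day_null h -> day_rel g h.

Definition day_base n : day_gen n := DayGen (add0n n) 1 ept ept.

Definition day_gact n (s : 'S_n) (g : day_gen n) : day_gen n :=
  DayGen (dg_e g) (dg_a g * s) (dg_x g) (dg_y g).

Lemma day_gact_rel n (s : 'S_n) g h :
  day_rel g h -> day_rel (day_gact s g) (day_gact s h).
Proof.
case=> [p q e a u v x y|{}g {}h gN hN]; last by apply: DayNull.
by rewrite /day_gact /= -mulgA; apply: DayInd.
Qed.

Definition day_act n (s : 'S_n) : quot (@day_rel n) -> quot (@day_rel n) :=
  quot_lift (fun g => cls (@day_rel n) (day_gact s g)).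

Lemma day_actE n (s : 'S_n) g :
  day_act s (cls _ g) = cls _ (day_gact s g).
Proof.
by rewrite /day_act quot_liftE // => u v h; apply/cls_eq/day_gact_rel.
Qed.

Program Definition day : SymPSet :=
  @mk_sympset (fun n => quot (@day_rel n)) (fun n => cls _ (day_base n))
    day_act _ _ _.
Next Obligation.
by move=> n s; rewrite day_actE; apply/cls_eq/DayNull; left.
Qed.
Next Obligation.
move=> n u; have [[p q e a x y] ->] := cls_surj u.
by rewrite day_actE /day_gact /= mulg1.
Qed.
Next Obligation.
move=> n s t u; have [[p q e a x y] ->] := cls_surj u.
by rewrite !day_actE /day_gact /= mulgA.
Qed.

(* The class [a; x, y]. *)
Definition dmk n p q (e : p + q = n) (a : 'S_n) (x : el X p) (y : el Y q) :
  el day n := cls (@day_rel n) (DayGen e a x y).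

Lemma dmk_act n p q (e : p + q = n) (a s : 'S_n) (x : el X p) (y : el Y q) :
  sact s (dmk e a x y) = dmk e (a * s) x y.
Proof. exact: day_actE. Qed.

Lemma dmk_ind n p q (e : p + q = n) a s t (x : el X p) (y : el Y q) :
  dmk e a (sact s x) (sact t y) = dmk e (cast_perm e (psum s t) * a) x y.
Proof. by apply/esym/cls_eq/DayInd. Qed.

Lemma dmk_ptl n p q (e : p + q = n) a (y : el Y q) :
  dmk e a (ept : el X p) y = ept.
Proof. by apply/cls_eq/DayNull; left. Qed.

Lemma dmk_ptr n p q (e : p + q = n) a (x : el X p) :
  dmk e a x (ept : el Y q) = ept.
Proof. by apply/cls_eq/DayNull; [right|left]. Qed.

Lemma day_elP n (u : el day n) :
  exists p q (e : p + q = n) a (x : el X p) (y : el Y q), u = dmk e a x y.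
Proof. by have [[p q e a x y] ->] := cls_surj u; exists p, q, e, a, x, y. Qed.

Lemma dmk_cast m n (E : m = n) p q (e : p + q = m) (e' : p + q = n) a
    (x : el X p) (y : el Y q) :
  scast E (dmk e a x y) = dmk e' (cast_perm E a) x y.
Proof. by subst m; rewrite scast_id cast_perm_id (eq_irrelevance e e'). Qed.

Lemma dmk_castl n p p' q (E : p = p') (e' : p' + q = n) (e : p + q = n) a
    (x : el X p) (y : el Y q) :
  dmk e' a (scast E x) y = dmk e a x y.
Proof. by subst p'; rewrite scast_id (eq_irrelevance e e'). Qed.

Lemma dmk_castr n p q q' (E : q = q') (e' : p + q' = n) (e : p + q = n) a
    (x : el X p) (y : el Y q) :
  dmk e' a x (scast E y) = dmk e a x y.
Proof. by subst q'; rewrite scast_id (eq_irrelevance e e'). Qed.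

Lemma dmk_eq n p q (e e' : p + q = n) a a' (x : el X p) (y : el Y q) :
  pval a =1 pval a' -> dmk e a x y = dmk e' a' x y.
Proof. by move=> E; rewrite (pval_inj E) (eq_irrelevance e e'). Qed.

(* Morphisms out of [day]: families of pointed equivariant pairings. *)
Section Elim.
Variables (Z : SymPSet) (b : forall p q, el X p -> el Y q -> el Z (p + q)).
Hypothesis b_ptl : forall p q (y : el Y q), b (ept : el X p) y = ept.
Hypothesis b_ptr : forall p q (x : el X p), b x (ept : el Y q) = ept.
Hypothesis b_act : forall p q (s : 'S_p) (t : 'S_q) x y,
  b (sact s x) (sact t y) = sact (psum s t) (b x y).

Definition day_gelim n (g : day_gen n) : el Z n :=
  sact (dg_a g) (scast (dg_e g) (b (dg_x g) (dg_y g))).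

Lemma day_gelim_null n (g : day_gen n) : day_null g -> day_gelim g = ept.
Proof.
by rewrite /day_gelim; case=> ->; rewrite ?b_ptl ?b_ptr scast_pt sact_pt.
Qed.

Lemma day_gelim_rel n (g h : day_gen n) :
  day_rel g h -> day_gelim g = day_gelim h.
Proof.
case=> [p q e a s t x y|{}g {}h gN hN]; last by rewrite !day_gelim_null.
by rewrite /day_gelim /= b_act scast_act sactM.
Qed.

Definition day_elim_fun n : el day n -> el Z n := quot_lift (@day_gelim n).

Lemma day_elim_funE n p q (e : p + q = n) a x y :
  day_elim_fun (dmk e a x y) = sact a (scast e (b x y)).
Proof. exact/quot_liftE/day_gelim_rel. Qed.

Lemma day_elim_pt n : @day_elim_fun n ept = ept.
Proof. by rewrite day_elim_funE b_ptl scast_pt sact_pt. Qed.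

Lemma day_elim_act n s x : @day_elim_fun n (sact s x) = sact s (day_elim_fun x).
Proof.
have [p [q [e [a [{}x [y ->]]]]]] := day_elP x.
by rewrite dmk_act !day_elim_funE sactM.
Qed.

Definition day_elim : sqhom day Z := mk_sqhom day_elim_pt day_elim_act.

Lemma day_elimE n p q (e : p + q = n) a x y :
  ap day_elim (dmk e a x y) = sact a (scast e (b x y)).
Proof. exact: day_elim_funE. Qed.

End Elim.

Lemma day_ext Z (f g : sqhom day Z) :
  (forall p q (x : el X p) (y : el Y q),
     ap f (dmk erefl 1 x y) = ap g (dmk erefl 1 x y)) -> f = g.
Proof.
move=> E; apply: sqhom_ext => n u; have [p [q [e [a [x [y ->]]]]]] := day_elP u.
by subst n; rewrite -[a]mul1g -dmk_act !ap_act E.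
Qed.

End Day.
Arguments dmk {X Y n p q} e a x y.
Arguments day_elim {X Y Z} b _ _ _.

Section DayStructure.

Lemma dmk_act1 X Y p q (s : 'S_p) (t : 'S_q) (x : el X p) (y : el Y q) :
  dmk erefl 1 (sact s x) (sact t y) = sact (psum s t) (dmk erefl 1 x y).
Proof. by rewrite dmk_ind cast_perm_id mulg1 dmk_act mul1g. Qed.

Lemma dmk_nestl X Y Z n m p q r (e : m + r = n) (e' : p + q = m)
    (e'' : (p + q) + r = n) a b (x : el X p) (y : el Y q) (z : el Z r) :
  dmk e a (dmk e' b x y) z =
  dmk e'' (cast_perm e (psum b 1) * a) (dmk erefl 1 x y) z.
Proof.
subst m; rewrite (eq_irrelevance e'' e) -dmk_ind sact1.
by rewrite dmk_act mul1g.
Qed.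

Lemma dmk_nestr X Y Z n m p q r (e : p + m = n) (e' : q + r = m)
    (e'' : p + (q + r) = n) a b (x : el X p) (y : el Y q) (z : el Z r) :
  dmk e a x (dmk e' b y z) =
  dmk e'' (cast_perm e (psum 1 b) * a) x (dmk erefl 1 y z).
Proof.
subst m; rewrite (eq_irrelevance e'' e) -dmk_ind sact1.
by rewrite dmk_act mul1g.
Qed.

(** Product of morphisms *)

Program Definition dmap X X' Y Y' (f : sqhom X X') (g : sqhom Y Y') :
    sqhom (day X Y) (day X' Y') :=
  day_elim (fun p q x y => dmk erefl 1 (ap f x) (ap g y)) _ _ _.
Next Obligation. by move=> *; rewrite ap_pt dmk_ptl. Qed.
Next Obligation. by move=> *; rewrite ap_pt dmk_ptr. Qed.
Next Obligation. by move=> *; rewrite !ap_act dmk_act1. Qed.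

Lemma dmapE X X' Y Y' (f : sqhom X X') (g : sqhom Y Y') n p q
    (e : p + q = n) a (x : el X p) (y : el Y q) :
  ap (dmap f g) (dmk e a x y) = dmk e a (ap f x) (ap g y).
Proof.
by rewrite day_elimE; subst n; rewrite scast_id dmk_act mul1g.
Qed.

(** Associativity *)

Program Definition rshift_seq (W : SymPSet) r : SymPSet :=
  @mk_sympset (fun n => el W (n + r)) (fun n => ept)
    (fun n s x => sact (psum s 1) x) _ _ _.
Next Obligation. by move=> *; rewrite sact_pt. Qed.
Next Obligation. by move=> *; rewrite psum11 sact1. Qed.
Next Obligation. by move=> *; rewrite -sactM psumM mulg1. Qed.

Program Definition lshift_seq (W : SymPSet) r : SymPSet :=
  @mk_sympset (fun n => el W (r + n)) (fun n => ept)
    (fun n s x => sact (psum 1 s) x) _ _ _.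
Next Obligation. by move=> *; rewrite sact_pt. Qed.
Next Obligation. by move=> *; rewrite psum11 sact1. Qed.
Next Obligation. by move=> *; rewrite -sactM psumM mulg1. Qed.

Section Assoc.
Variables X Y Z : SymPSet.

Program Definition dassoc_in r (z : el Z r) :
    sqhom (day X Y) (rshift_seq (day X (day Y Z)) r) :=
  @day_elim _ _ (rshift_seq (day X (day Y Z)) r)
    (fun p q x y => dmk (addnA p q r) 1 x (dmk erefl 1 y z)) _ _ _.
Next Obligation. by move=> r z p q y; rewrite dmk_ptl. Qed.
Next Obligation. by move=> r z p q x; rewrite dmk_ptl dmk_ptr. Qed.
Next Obligation.
move=> r z p q s t x y; rewrite -{1}[z]sact1 dmk_act1 dmk_ind.
rewrite [RHS]dmk_act; apply: dmk_eq => i; rewrite !pvalE.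
have hp := pval_lt s i; have hq := pval_lt t (i - p).
by case: (ltnP i p) hp hq; case: (ltnP i (p + q)) => ? ?;
   case: (ltnP (i - p) q) => ? hp hq; rewrite ?pval1; lia.
Qed.

Lemma dassoc_inE r (z : el Z r) m p q (e : p + q = m)
    (e' : p + (q + r) = m + r) b (x : el X p) (y : el Y q) :
  ap (dassoc_in z) (dmk e b x y) = dmk e' (psum b 1) x (dmk erefl 1 y z).
Proof.
rewrite day_elimE; subst m; rewrite scast_id [LHS]dmk_act mul1g.
by rewrite (eq_irrelevance e' (addnA p q r)).
Qed.

Program Definition dassoc : sqhom (day (day X Y) Z) (day X (day Y Z)) :=
  day_elim (fun m r u z => ap (dassoc_in z) u : el (day X (day Y Z)) (m + r))
    _ _ _.
Next Obligation. by move=> *; rewrite ap_pt. Qed.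
Next Obligation.
move=> m r u; have [p [q [e [b [x [y ->]]]]]] := day_elP u.
have e' : p + (q + r) = m + r by rewrite addnA e.
by rewrite (dassoc_inE _ _ e') !dmk_ptr.
Qed.
Next Obligation.
move=> m r s t u z; have [p [q [e [b [x [y ->]]]]]] := day_elP u.
have e' : p + (q + r) = m + r by rewrite addnA e.
rewrite dmk_act !(dassoc_inE _ _ e') dmk_act.
rewrite -{1}[y]sact1 dmk_act1 -{1}[x]sact1 dmk_ind.
apply: dmk_eq => i; rewrite !pvalE.
subst m; have hb := pval_lt b i.
have -> : (if i < p then i
           else p + (if i - p < q then i - p else q + pval t (i - p - q)))
          = if i < p + q then i else p + q + pval t (i - (p + q)).
  have -> : i - (p + q) = i - p - q by lia.
  by case: (ltnP i p); case: (ltnP i (p + q)) => ? ?;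
     case: (ltnP (i - p) q) => ?; lia.
case: (ltnP i (p + q)) => h; first by rewrite hb h.
by rewrite ![_ + _ < _]ltnNge !leq_addr /= !addKn.
Qed.

Lemma dassocE n m p q r (e : m + r = n) (e' : p + q = m)
    (e'' : p + (q + r) = n) a b (x : el X p) (y : el Y q) (z : el Z r) :
  ap dassoc (dmk e a (dmk e' b x y) z) =
  dmk e'' (cast_perm e (psum b 1) * a) x (dmk erefl 1 y z).
Proof.
rewrite day_elimE; subst m n; rewrite scast_id (dassoc_inE _ _ e'') dmk_act.
by rewrite cast_perm_id.
Qed.

Program Definition dassoc'_in p (x : el X p) :
    sqhom (day Y Z) (lshift_seq (day (day X Y) Z) p) :=
  @day_elim _ _ (lshift_seq (day (day X Y) Z) p)
    (fun q r y z => dmk (esym (addnA p q r)) 1 (dmk erefl 1 x y) z) _ _ _.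
Next Obligation. by move=> p x q r z; rewrite dmk_ptr dmk_ptl. Qed.
Next Obligation. by move=> p x q r y; rewrite dmk_ptr. Qed.
Next Obligation.
move=> p x q r s t y z; rewrite -{1}[x]sact1 dmk_act1 dmk_ind.
rewrite [RHS]dmk_act; apply: dmk_eq => i; rewrite !pvalE.
have -> : i - (p + q) = i - p - q by lia.
by case: (ltnP i p); case: (ltnP i (p + q)) => ? ?;
   case: (ltnP (i - p) q) => ?; rewrite ?pval1; lia.
Qed.

Lemma dassoc'_inE p (x : el X p) m q r (e : q + r = m)
    (e' : (p + q) + r = p + m) b (y : el Y q) (z : el Z r) :
  ap (dassoc'_in x) (dmk e b y z) = dmk e' (psum 1 b) (dmk erefl 1 x y) z.
Proof.
rewrite day_elimE; subst m; rewrite scast_id [LHS]dmk_act mul1g.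
by rewrite (eq_irrelevance e' (esym (addnA p q r))).
Qed.

Program Definition dassoc' : sqhom (day X (day Y Z)) (day (day X Y) Z) :=
  day_elim (fun p m x u => ap (dassoc'_in x) u : el (day (day X Y) Z) (p + m))
    _ _ _.
Next Obligation.
move=> p m u; have [q [r [e [b [y [z ->]]]]]] := day_elP u.
have e' : (p + q) + r = p + m by rewrite -addnA e.
by rewrite (dassoc'_inE _ _ e') !dmk_ptl.
Qed.
Next Obligation. by move=> *; rewrite ap_pt. Qed.
Next Obligation.
move=> p m s t x u; have [q [r [e [b [y [z ->]]]]]] := day_elP u.
have e' : (p + q) + r = p + m by rewrite -addnA e.
rewrite dmk_act !(dassoc'_inE _ _ e') dmk_act.
rewrite -{1}[y]sact1 dmk_act1 -{1}[z]sact1 dmk_ind.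
apply: dmk_eq => i; rewrite !pvalE; subst m.
have hs := pval_lt s i.
have -> : (if i < p + q then if i < p then pval s i else p + (i - p)
           else p + q + (i - (p + q)))
          = if i < p then pval s i else p + (i - p).
  by case: (ltnP i p); case: (ltnP i (p + q)) => ? ?; lia.
case: (ltnP i p) hs => h hs; first by rewrite hs h.
by rewrite ![p + _ < _]ltnNge !leq_addr /= !addKn.
Qed.

Lemma dassoc'E n m p q r (e : p + m = n) (e' : q + r = m)
    (e'' : (p + q) + r = n) a b (x : el X p) (y : el Y q) (z : el Z r) :
  ap dassoc' (dmk e a x (dmk e' b y z)) =
  dmk e'' (cast_perm e (psum 1 b) * a) (dmk erefl 1 x y) z.
Proof.
rewrite day_elimE; subst m n; rewrite scast_id (dassoc'_inE _ _ e'') dmk_act.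
by rewrite cast_perm_id.
Qed.

End Assoc.

(** Symmetry: the class [a; x, y] is sent to [a ∘ chi q p; y, x] *)

Program Definition dsw X Y : sqhom (day X Y) (day Y X) :=
  day_elim (fun p q x y => dmk (addnC q p) (cast_perm (addnC q p) (chi q p)) y x)
    _ _ _.
Next Obligation. by move=> *; rewrite dmk_ptr. Qed.
Next Obligation. by move=> *; rewrite dmk_ptl. Qed.
Next Obligation.
move=> X Y p q s t x y; rewrite dmk_ind dmk_act; apply: dmk_eq => i.
rewrite !pvalE.
case: (ltnP i q) => h1.
  by rewrite pval_lt h1 addnK ltnNge leq_addl /= addnC.
rewrite [q + _ < q]ltnNge leq_addr /= ltn_add2l pval_lt.
case: (ltnP i (q + p)) => h2.
  have -> : i - q < p by lia.
  by rewrite addKn.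
have -> : (i - q < p) = false by lia.
have -> : (i < p) = false by lia.
by rewrite !pval_out; lia.
Qed.

Lemma dswE X Y n p q (e : p + q = n) (e' : q + p = n) a
    (x : el X p) (y : el Y q) :
  ap (dsw X Y) (dmk e a x y) =
  dmk e' (cast_perm e' (chi q p) * a) y x.
Proof.
rewrite day_elimE; subst n; rewrite scast_id dmk_act.
by rewrite (eq_irrelevance (addnC q p) e').
Qed.

(** The unit (S, 0, 0, ...), with S the set {false, true} based at false *)

Definition dunit_ob (n : nat) : Type := if n is 0 then bool else unit.

Definition dunit_pt n : dunit_ob n :=
  match n with 0 => false | _.+1 => tt end.

Program Definition dunit : SymPSet :=
  @mk_sympset dunit_ob dunit_pt (fun n _ x => x) _ _ _.
Next Obligation. by []. Qed.
Next Obligation. by []. Qed.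
Next Obligation. by []. Qed.

Definition dunit1 : el dunit 0 := true.

Definition dlunit_fun X p q : el dunit p -> el X q -> el X (p + q) :=
  match p return el dunit p -> el X q -> el X (p + q) with
  | 0 => fun u x => if (u : bool) then x else ept
  | _ => fun _ _ => ept
  end.

Program Definition dlunit X : sqhom (day dunit X) X :=
  day_elim (@dlunit_fun X) _ _ _.
Next Obligation. by move=> X [|p] q x. Qed.
Next Obligation. by move=> X [|p] q //= [] . Qed.
Next Obligation.
move=> X [|p] q s t //= [] x /=; rewrite ?sact_pt //.
by congr sact; apply: pval_inj => i; rewrite pval_psum /= subn0.
Qed.

Lemma dlunitE X n (e : 0 + n = n) a (x : el X n) :
  ap (dlunit X) (dmk e a dunit1 x) = sact a x.
Proof. by rewrite day_elimE scast_id. Qed.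

Program Definition dlunit' X : sqhom X (day dunit X) :=
  mk_sqhom (f := fun n x => dmk (add0n n) 1 dunit1 x) _ _.
Next Obligation. by move=> *; rewrite dmk_ptr. Qed.
Next Obligation.
move=> X n s x; rewrite dmk_act -[dunit1](@sact1 dunit 0) dmk_ind.
by rewrite sact1; apply: dmk_eq => i; rewrite !pvalE /= subn0.
Qed.

Definition drunit_fun X p q (x : el X p) : el dunit q -> el X (p + q) :=
  match q return el dunit q -> el X (p + q) with
  | 0 => fun u => if (u : bool) then scast (esym (addn0 p)) x else ept
  | _ => fun _ => ept
  end.

Program Definition drunit X : sqhom (day X dunit) X :=
  day_elim (@drunit_fun X) _ _ _.
Next Obligation. by move=> X p [|q] //= []; rewrite ?scast_pt. Qed.
Next Obligation. by move=> X p [|q] x. Qed.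
Next Obligation.
move=> X p [|q] s t //= x; last by rewrite sact_pt.
case=> /=; rewrite ?sact_pt // scast_act.
congr sact; apply: pval_inj => i; rewrite !pvalE.
by case: ltnP => // h; rewrite !pval_out //; lia.
Qed.

Lemma drunitE X n (e : n + 0 = n) a (x : el X n) :
  ap (drunit X) (dmk e a x dunit1) = sact a x.
Proof. by rewrite day_elimE /= scast_comp scast_id. Qed.

Program Definition drunit' X : sqhom X (day X dunit) :=
  mk_sqhom (f := fun n x => dmk (addn0 n) 1 x dunit1) _ _.
Next Obligation. by move=> *; rewrite dmk_ptl. Qed.
Next Obligation.
move=> X n s x; rewrite dmk_act -[dunit1](@sact1 dunit 0) dmk_ind.
rewrite sact1; apply: dmk_eq => i; rewrite !pvalE.
by case: ltnP => // h; rewrite !pval_out //; lia.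
Qed.

End DayStructure.

Section DayLaws.

Lemma dmap_id X Y : dmap (sqid X) (sqid Y) = sqid (day X Y).
Proof. by apply: day_ext => p q x y; rewrite dmapE. Qed.

Lemma dmap_comp X X' X'' Y Y' Y'' (f' : sqhom X' X'') (f : sqhom X X')
    (g' : sqhom Y' Y'') (g : sqhom Y Y') :
  dmap (sqcomp f' f) (sqcomp g' g) = sqcomp (dmap f' g') (dmap f g).
Proof. by apply: day_ext => p q x y; rewrite ap_comp !dmapE. Qed.

Lemma dassocK X Y Z : sqcomp (dassoc' X Y Z) (dassoc X Y Z) = sqid _.
Proof.
apply: day_ext => m r u z; rewrite ap_comp.
have [p [q [e [a [x [y ->]]]]]] := day_elP u; subst m.
rewrite (dassocE _ _ (addnA p q r)) (dassoc'E _ _ erefl) [RHS]dmk_nestl.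
by apply: dmk_eq => i; rewrite !psum11 !pvalE.
Qed.

Lemma dassoc'K X Y Z : sqcomp (dassoc X Y Z) (dassoc' X Y Z) = sqid _.
Proof.
apply: day_ext => p m x u; rewrite ap_comp.
have [q [r [e [a [y [z ->]]]]]] := day_elP u; subst m.
rewrite (dassoc'E _ _ (esym (addnA p q r))) (dassocE _ _ erefl) [RHS]dmk_nestr.
by apply: dmk_eq => i; rewrite !psum11 !pvalE.
Qed.

Lemma dassoc_nat X X' Y Y' Z Z'
    (f : sqhom X X') (g : sqhom Y Y') (h : sqhom Z Z') :
  sqcomp (dassoc X' Y' Z') (dmap (dmap f g) h)
  = sqcomp (dmap f (dmap g h)) (dassoc X Y Z).
Proof.
apply: day_ext => m r u z; rewrite !ap_comp.
have [p [q [e [a [x [y ->]]]]]] := day_elP u; subst m.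
by rewrite !dmapE !(dassocE _ _ (addnA p q r)) !dmapE.
Qed.

Lemma dlunitK X : sqcomp (dlunit' X) (dlunit X) = sqid _.
Proof.
apply: day_ext => -[|p] q u x; rewrite ap_comp; last first.
  by case: u; rewrite !(dmk_ptl _ _ _ (p := p.+1)) !ap_pt.
case: u; last by rewrite !(dmk_ptl _ _ _ (p := 0)) !ap_pt.
by rewrite dlunitE sact1; apply: dmk_eq.
Qed.

Lemma dlunit'K X : sqcomp (dlunit X) (dlunit' X) = sqid _.
Proof. by apply: sqhom_ext => n x; rewrite ap_comp dlunitE sact1. Qed.

Lemma drunitK X : sqcomp (drunit' X) (drunit X) = sqid _.
Proof.
apply: day_ext => p q x u; rewrite ap_comp; case: q u => [|q] u; last first.
  by case: u; rewrite !(dmk_ptr _ _ _ (q := q.+1)) !ap_pt.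
case: u; last by rewrite !(dmk_ptr _ _ _ (q := 0)) !ap_pt.
rewrite day_elimE sact1 scast_id [drunit_fun _ _]/(scast _ _) ap_cast.
rewrite (dmk_cast _ (addn0 p) erefl).
by apply: dmk_eq => i; rewrite !pvalE.
Qed.

Lemma drunit'K X : sqcomp (drunit X) (drunit' X) = sqid _.
Proof. by apply: sqhom_ext => n x; rewrite ap_comp drunitE sact1. Qed.

Lemma dlunit_nat X X' (f : sqhom X X') :
  sqcomp (dlunit X') (dmap (sqid dunit) f) = sqcomp f (dlunit X).
Proof.
apply: day_ext => p q u x; rewrite !ap_comp dmapE !day_elimE !ap_id.
by case: p u => [|p] //= []; rewrite /= !sact1 ?ap_pt.
Qed.

Lemma drunit_nat X X' (f : sqhom X X') :
  sqcomp (drunit X') (dmap f (sqid dunit)) = sqcomp f (drunit X).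
Proof.
apply: day_ext => p q x u; rewrite !ap_comp dmapE !day_elimE !ap_id.
rewrite !sact1 !scast_id; case: q u => [|q] u; last by rewrite /= ap_pt.
by case: u; rewrite /= ?ap_cast ?ap_pt.
Qed.

Lemma dswK X Y : sqcomp (dsw Y X) (dsw X Y) = sqid _.
Proof.
apply: day_ext => p q x y.
rewrite ap_comp (dswE _ (addnC q p)) (dswE _ erefl).
apply: dmk_eq => i; rewrite !pvalE.
by case_ltn; lia.
Qed.

Lemma dsw_nat X X' Y Y' (f : sqhom X X') (g : sqhom Y Y') :
  sqcomp (dsw X' Y') (dmap f g) = sqcomp (dmap g f) (dsw X Y).
Proof.
by apply: day_ext => p q x y; rewrite !ap_comp dmapE !(dswE _ (addnC q p)) dmapE.
Qed.


Lemma dtriangle X Y :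
  sqcomp (dmap (sqid X) (dlunit Y)) (dassoc X dunit Y)
  = dmap (drunit X) (sqid Y).
Proof.
apply: day_ext => m r u y; rewrite !ap_comp.
have [p [q [e [a [x [v ->]]]]]] := day_elP u.
rewrite !dmapE !ap_id; case: q e v => [|q] e v; last first.
  by case: v; rewrite (dmk_ptr _ _ _ (q := q.+1)) !(ap_pt, dmk_ptl).
case: v; last by rewrite (dmk_ptr _ _ _ (q := 0)) !(ap_pt, dmk_ptl).
have e' : p + r = m + r by rewrite -e addn0.
rewrite (dassocE _ _ (e' : p + (0 + r) = _)) dmapE ap_id dlunitE sact1.
rewrite day_elimE [drunit_fun _ _]/(scast _ _) scast_comp.
rewrite -{2}[y]sact1 dmk_ind (dmk_castl _ _ e').
by apply: dmk_eq => i; rewrite !pvalE.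
Qed.

Lemma dpentagon X Y Z W :
  sqcomp (dassoc X Y (day Z W)) (dassoc (day X Y) Z W)
  = sqcomp (sqcomp (dmap (sqid X) (dassoc Y Z W)) (dassoc X (day Y Z) W))
      (dmap (dassoc X Y Z) (sqid W)).
Proof.
apply: day_ext => n s v w; rewrite !ap_comp.
have [m [r [e [a [u [z ->]]]]]] := day_elP v; subst n.
have [p [q [e [b [x [y ->]]]]]] := day_elP u; subst m.
rewrite (dassocE _ _ (addnA (p + q) r s)).
rewrite (dassocE _ _ (etrans (addnA p q (r + s)) (addnA (p + q) r s))).
rewrite dmapE (dassocE _ _ (addnA p q r)) ap_id.
rewrite (dassocE _ _ (etrans (addnA p (q + r) s) (congr1 (addn^~ s) (addnA p q r)))).
rewrite dmapE ap_id (dassocE _ _ (addnA q r s)).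
rewrite [RHS](dmk_nestr _ _ (etrans (addnA p q (r + s)) (addnA (p + q) r s))).
apply: dmk_eq => i; rewrite !psum11 !pvalE.
have E k : (if i < k then i else k + (i - k)) = i by case_ltn; lia.
rewrite !E; have hb := pval_lt b i.
case: (ltnP i (p + q)) hb => h hb; last by rewrite subnKC.
by have [-> ->] : pval b i < p + q + r /\ i < p + q + r by lia.
Qed.

Lemma dhexagon X Y Z :
  sqcomp (sqcomp (dassoc Y Z X) (dsw X (day Y Z))) (dassoc X Y Z)
  = sqcomp (sqcomp (dmap (sqid Y) (dsw X Z)) (dassoc Y X Z))
      (dmap (dsw X Y) (sqid Z)).
Proof.
apply: day_ext => m r u z; rewrite !ap_comp.
have [p [q [e [a [x [y ->]]]]]] := day_elP u; subst m.
have e1 : q + (r + p) = p + q + r by lia.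
have e2 : q + (p + r) = p + q + r by lia.
have e3 : q + r + p = p + q + r by lia.
rewrite (dassocE _ _ (addnA p q r)) (dswE _ e3) (dassocE _ _ e1).
rewrite dmapE (dswE _ (addnC q p)) ap_id (dassocE _ _ e2).
rewrite dmapE ap_id (dswE _ (addnC r p)) [RHS](dmk_nestr _ _ e1).
apply: dmk_eq => i; rewrite !psum11 !pvalE.
by case_ltn; first [lia | congr (pval a _); lia].
Qed.

End DayLaws.

Program Definition SymPSetMon : SymMonCat :=
  @MkSymMonCat (SymSeqCat PSetCat) day dmap dunit dassoc dassoc'
    dlunit dlunit' drunit drunit' dsw dmap_id dmap_comp
    _ _ _ _ dassoc_nat dlunit_nat drunit_nat dsw_nat
    dtriangle dpentagon dhexagon.
Next Obligation. by move=> X Y Z; split; [apply: dassocK|apply: dassoc'K]. Qed.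
Next Obligation. by move=> X; split; [apply: dlunitK|apply: dlunit'K]. Qed.
Next Obligation. by move=> X; split; [apply: drunitK|apply: drunit'K]. Qed.
Next Obligation. by move=> X Y; split; apply: dswK. Qed.

(** The internal hom of symmetric sequences of pointed sets: in degree [n],
the morphisms from [X] to the sequence [m |-> Y (n + m)]. *)

Section InternalHom.
Variables X Y : SymPSet.

Definition ihom_ob n : Type := sqhom X (lshift_seq Y n).

Program Definition ihom_pt n : ihom_ob n :=
  @mk_sqhom X (lshift_seq Y n) (fun m x => ept) _ _.
Next Obligation. by []. Qed.
Next Obligation. by move=> *; rewrite sact_pt. Qed.

Program Definition ihom_act n (s : 'S_n) (f : ihom_ob n) : ihom_ob n :=
  @mk_sqhom X (lshift_seq Y n)
    (fun m x => @sact Y (n + m) (psum s 1) (ap f x)) _ _.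
Next Obligation. by move=> n s f m; rewrite ap_pt [LHS]sact_pt. Qed.
Next Obligation.
move=> n s f m t x; rewrite ap_act.
by rewrite [LHS](esym (sactM _ _ _)) [RHS](esym (sactM _ _ _)) !psumM !mulg1 !mul1g.
Qed.

Program Definition ihom : SymPSet :=
  @mk_sympset ihom_ob ihom_pt ihom_act _ _ _.
Next Obligation. by move=> n s; apply: sqhom_ext => m x; exact: (@sact_pt Y). Qed.
Next Obligation.
move=> n f; apply: sqhom_ext => m x.
by rewrite -[LHS]/(@sact Y (n + m) (psum 1 1) (ap f x)) psum11 sact1.
Qed.
Next Obligation.
move=> n s t f; apply: sqhom_ext => m x.
rewrite -[LHS]/(@sact Y (n + m) (psum (s * t) 1) (ap f x)).
by rewrite -[in LHS](mulg1 1) -psumM sactM.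
Qed.

Program Definition ieval : sqhom (day ihom X) Y :=
  day_elim (fun n m (f : el ihom n) x =>
    @ap X (lshift_seq Y n) f m x : el Y (n + m)) _ _ _.
Next Obligation. by []. Qed.
Next Obligation. by move=> n m f; rewrite ap_pt. Qed.
Next Obligation.
move=> n m s t f x.
rewrite -[LHS]/(@sact Y (n + m) (psum s 1) (ap f (sact t x))) ap_act.
by rewrite -[X in sact _ X]/(@sact Y (n + m) (psum 1 t) (ap f x))
   -sactM psumM mul1g mulg1.
Qed.

Program Definition icurry_in W (g : sqhom (day W X) Y) n (w : el W n) :
    ihom_ob n :=
  @mk_sqhom X (lshift_seq Y n) (fun m x => ap g (dmk erefl 1 w x)) _ _.
Next Obligation. by move=> W g n w m; rewrite dmk_ptr ap_pt. Qed.
Next Obligation.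
by move=> W g n w m s x; rewrite -{1}[w]sact1 dmk_act1 ap_act.
Qed.

Program Definition icurry W (g : sqhom (day W X) Y) : sqhom W ihom :=
  @mk_sqhom W ihom (fun n w => icurry_in g w) _ _.
Next Obligation.
move=> W g n; apply: sqhom_ext => m x.
by rewrite -[LHS]/(ap g (dmk erefl 1 ept x)) dmk_ptl ap_pt.
Qed.
Next Obligation.
move=> W g n s w; apply: sqhom_ext => m x.
rewrite -[LHS]/(ap g (dmk erefl 1 (sact s w) x)).
by rewrite -{1}[x]sact1 dmk_act1 ap_act.
Qed.

End InternalHom.

Lemma SymPSetMon_closed : is_closed SymPSetMon.
Proof.
move=> X Y; exists (ihom X Y), (ieval X Y) => W g; exists (icurry g).
split=> [|h hE].
  apply: day_ext => n m w x; rewrite ap_comp dmapE ap_id.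
  by rewrite day_elimE sact1.
apply: sqhom_ext => n w; apply: sqhom_ext => m x.
rewrite -[LHS]/(ap g (dmk erefl 1 w x)) -hE.
by rewrite [LHS]ap_comp dmapE ap_id day_elimE sact1.
Qed.

(** * Enriched categories

Compositions are written in diagrammatic order, as maps
[A(X, Y) ⊗ A(Y, Z) -> A(X, Z)].  Data are kept apart from laws, so that the
tensor product of two enriched categories and the functors between them can be
written without proving the laws of an enriched category for it. *)

Section Enriched.
Variable V : SymMonCat.

Record VCatData := MkVCatData {
  vob :> Type;
  vhom : vob -> vob -> V;
  vcomp : forall X Y Z, Hom (vhom X Y ⊗ vhom Y Z) (vhom X Z);
  vid : forall X, Hom munit (vhom X X)
}.

Definition is_vcat (A : VCatData) : Prop :=
  [/\ forall X Y Z W : A,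
        vcomp X Z W ∘ (vcomp X Y Z ⊠ idm (vhom Z W))
        = vcomp X Y W ∘ (idm (vhom X Y) ⊠ vcomp Y Z W) ∘ massoc _ _ _,
      forall X Y : A,
        vcomp X X Y ∘ (vid X ⊠ idm (vhom X Y)) = lunit (vhom X Y)
    & forall X Y : A,
        vcomp X Y Y ∘ (idm (vhom X Y) ⊠ vid Y) = runit (vhom X Y)].

Record VFunData (A B : VCatData) := MkVFunData {
  vfob :> A -> B;
  vfhom : forall X Y : A, Hom (vhom X Y) (vhom (vfob X) (vfob Y))
}.

Definition is_vfun A B (F : VFunData A B) : Prop :=
  (forall X Y Z : A,
     vfhom F X Z ∘ vcomp X Y Z
     = vcomp (F X) (F Y) (F Z) ∘ (vfhom F X Y ⊠ vfhom F Y Z)) /\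
  (forall X : A, vfhom F X X ∘ vid X = vid (F X)).

Definition vfun_id A : VFunData A A :=
  @MkVFunData A A (fun X => X) (fun X Y => idm (vhom X Y)).

Definition vfun_comp A B C (G : VFunData B C) (F : VFunData A B) :
    VFunData A C :=
  @MkVFunData A C (fun X => G (F X))
    (fun X Y => vfhom G (F X) (F Y) ∘ vfhom F X Y).

(* Morphisms X -> Y of the underlying ordinary category. *)
Definition uhom (A : VCatData) (X Y : A) : Type := Hom munit (vhom X Y).

Definition ucomp (A : VCatData) (X Y Z : A) (f : uhom X Y) (g : uhom Y Z) :
    uhom X Z :=
  vcomp X Y Z ∘ (f ⊠ g) ∘ lunit' munit.

Definition u_inverse (A : VCatData) (X Y : A) (f : uhom X Y) (g : uhom Y X) :
    Prop :=
  ucomp f g = vid X /\ ucomp g f = vid Y.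

Definition is_vnat A B (F G : VFunData A B)
    (h : forall X : A, uhom (F X) (G X)) : Prop :=
  forall X Y : A,
    vcomp (F X) (F Y) (G Y) ∘ (vfhom F X Y ⊠ h Y) ∘ runit' (vhom X Y)
    = vcomp (F X) (G X) (G Y) ∘ (h X ⊠ vfhom G X Y) ∘ lunit' (vhom X Y).

Definition is_vnatiso A B (F G : VFunData A B)
    (h : forall X : A, uhom (F X) (G X)) : Prop :=
  is_vnat h /\ forall X, exists k, u_inverse (h X) k.

(** Tensor product of enriched categories *)

(* (A ⊗ B) ⊗ (C ⊗ D) -> (A ⊗ C) ⊗ (B ⊗ D) *)
Definition interchange (A B C D : V) :
    Hom ((A ⊗ B) ⊗ (C ⊗ D)) ((A ⊗ C) ⊗ (B ⊗ D)) :=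
  massoc' A C (B ⊗ D)
  ∘ (idm A ⊠ (massoc C B D ∘ (msw B C ⊠ idm D) ∘ massoc' B C D))
  ∘ massoc A B (C ⊗ D).

Definition vtens (A B : VCatData) : VCatData :=
  @MkVCatData (A * B)%type
    (fun X Y => vhom X.1 Y.1 ⊗ vhom X.2 Y.2)
    (fun X Y Z =>
       (vcomp X.1 Y.1 Z.1 ⊠ vcomp X.2 Y.2 Z.2)
       ∘ interchange (vhom X.1 Y.1) (vhom X.2 Y.2) (vhom Y.1 Z.1) (vhom Y.2 Z.2))
    (fun X => (vid X.1 ⊠ vid X.2) ∘ lunit' munit).

Definition vtens_fun A A' B B' (F : VFunData A A') (G : VFunData B B') :
    VFunData (vtens A B) (vtens A' B') :=
  @MkVFunData (vtens A B) (vtens A' B')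
    (fun X => (F X.1, G X.2))
    (fun X Y => vfhom F X.1 Y.1 ⊠ vfhom G X.2 Y.2).

Definition vtens_assoc A B C :
    VFunData (vtens (vtens A B) C) (vtens A (vtens B C)) :=
  @MkVFunData (vtens (vtens A B) C) (vtens A (vtens B C))
    (fun X => (X.1.1, (X.1.2, X.2)))
    (fun X Y => massoc (vhom X.1.1 Y.1.1) (vhom X.1.2 Y.1.2) (vhom X.2 Y.2)).

Definition vtens_sw A B : VFunData (vtens A B) (vtens B A) :=
  @MkVFunData (vtens A B) (vtens B A)
    (fun X => (X.2, X.1))
    (fun X Y => msw (vhom X.1 Y.1) (vhom X.2 Y.2)).

(* The functors X |-> (J, X) and X |-> (X, J). *)
Definition vtens_left (A B : VCatData) (J : A) : VFunData B (vtens A B) :=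
  @MkVFunData B (vtens A B) (fun X => (J, X))
    (fun X Y => (vid J ⊠ idm (vhom X Y)) ∘ lunit' (vhom X Y)).

Definition vtens_right (A B : VCatData) (J : B) : VFunData A (vtens A B) :=
  @MkVFunData A (vtens A B) (fun X => (X, J))
    (fun X Y => (idm (vhom X Y) ⊠ vid J) ∘ runit' (vhom X Y)).

(** Symmetric monoidal structures, with a given product and unit on objects *)

Section SymMonVCat.
Variables (A : VCatData) (prod : A -> A -> A) (J : A).

Definition prod_fun
    (T : forall X X' Y Y' : A,
       Hom (vhom X X' ⊗ vhom Y Y') (vhom (prod X Y) (prod X' Y'))) :
    VFunData (vtens A A) A :=
  @MkVFunData (vtens A A) A (fun X => prod X.1 X.2)
    (fun X Y => T X.1 Y.1 X.2 Y.2).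

(* The product of two morphisms of the underlying category. *)
Definition uprod
    (T : forall X X' Y Y' : A,
       Hom (vhom X X' ⊗ vhom Y Y') (vhom (prod X Y) (prod X' Y')))
    (X X' Y Y' : A) (f : uhom X X') (g : uhom Y Y') :
    uhom (prod X Y) (prod X' Y') :=
  T X X' Y Y' ∘ (f ⊠ g) ∘ lunit' munit.

Record SymMonVCat := MkSymMonVCat {
  vprod : forall X X' Y Y' : A,
    Hom (vhom X X' ⊗ vhom Y Y') (vhom (prod X Y) (prod X' Y'));
  vassoc : forall X Y Z : A, uhom (prod (prod X Y) Z) (prod X (prod Y Z));
  vlunit : forall X : A, uhom (prod J X) X;
  vrunit : forall X : A, uhom (prod X J) X;
  vsw : forall X Y : A, uhom (prod X Y) (prod Y X);
  vprod_is_vfun : is_vfun (prod_fun vprod);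
  vassoc_nat : is_vnatiso
    (F := vfun_comp (prod_fun vprod) (vtens_fun (prod_fun vprod) (vfun_id A)))
    (G := vfun_comp (prod_fun vprod)
            (vfun_comp (vtens_fun (vfun_id A) (prod_fun vprod)) (vtens_assoc A A A)))
    (fun X => vassoc X.1.1 X.1.2 X.2);
  vlunit_nat : is_vnatiso
    (F := vfun_comp (prod_fun vprod) (vtens_left A J)) (G := vfun_id A) vlunit;
  vrunit_nat : is_vnatiso
    (F := vfun_comp (prod_fun vprod) (vtens_right A J)) (G := vfun_id A) vrunit;
  vsw_nat : is_vnatiso
    (F := prod_fun vprod) (G := vfun_comp (prod_fun vprod) (vtens_sw A A))
    (fun X => vsw X.1 X.2);
  vswK : forall X Y, ucomp (vsw X Y) (vsw Y X) = vid (prod X Y);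
  vtriangle : forall X Y,
    ucomp (vassoc X J Y) (uprod vprod (vid X) (vlunit Y))
    = uprod vprod (vrunit X) (vid Y);
  vpentagon : forall X Y Z W,
    ucomp (vassoc (prod X Y) Z W) (vassoc X Y (prod Z W))
    = ucomp (uprod vprod (vassoc X Y Z) (vid W))
        (ucomp (vassoc X (prod Y Z) W)
           (uprod vprod (vid X) (vassoc Y Z W)));
  vhexagon : forall X Y Z,
    ucomp (vassoc X Y Z) (ucomp (vsw X (prod Y Z)) (vassoc Y Z X))
    = ucomp (uprod vprod (vsw X Y) (vid Z))
        (ucomp (vassoc Y X Z) (uprod vprod (vid Y) (vsw X Z)))
}.

End SymMonVCat.

End Enriched.

(** * Tensor powers *)

Section TensorPowers.
Variables (C : SymMonCat) (P : C).

Fixpoint tpow (n : nat) : C := if n is n'.+1 then P ⊗ tpow n' else munit.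

Fixpoint tpow_split (n m : nat) : Hom (tpow (n + m)) (tpow n ⊗ tpow m) :=
  match n with
  | 0 => lunit' (tpow m)
  | n'.+1 => massoc' P (tpow n') (tpow m) ∘ (idm P ⊠ tpow_split n' m)
  end.

(* Moves the first factor past the next [k] ones. *)
Fixpoint tpow_ins (n k : nat) : Hom (P ⊗ tpow n) (P ⊗ tpow n) :=
  match n, k with
  | n'.+1, k'.+1 =>
    (idm P ⊠ tpow_ins n' k')
    ∘ (massoc P P (tpow n') ∘ (msw P P ⊠ idm (tpow n'))
       ∘ massoc' P P (tpow n'))
  | _, _ => idm _
  end.

(* The left action permuting the factors: the factor at position [i] moves to
   position [s i].  The last [n] factors are first permuted among themselves,
   then the first one is moved to position [s 0], see [perm_tailP]. *)
Fixpoint tpow_act (n : nat) : 'S_n -> Hom (tpow n) (tpow n) :=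
  match n return 'S_n -> Hom (tpow n) (tpow n) with
  | 0 => fun _ => idm _
  | n'.+1 => fun s =>
      tpow_ins n' (s ord0) ∘ (idm P ⊠ tpow_act (perm_tail s))
  end.

(* X ∧ P^n, which is X itself for n = 0. *)
Definition xpow (X : C) (n : nat) : C := if n is 0 then X else X ⊗ tpow n.

Definition xpow_in (X : C) (n : nat) : Hom (xpow X n) (X ⊗ tpow n) :=
  match n with 0 => runit' X | n'.+1 => idm (X ⊗ tpow n'.+1) end.

Definition xpow_out (X : C) (n : nat) : Hom (X ⊗ tpow n) (xpow X n) :=
  match n with 0 => runit X | n'.+1 => idm (X ⊗ tpow n'.+1) end.

End TensorPowers.

(** * E-correspondences *)

Section Corr.
Variables (C : SymMonCat) (O : ZeroObject C) (P : C) (E : RingObject C).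

Definition corr_set (X Y : C) (n : nat) : PSet :=
  @MkPSet (Hom (xpow P X n) (Y ⊗ E n)) (zero_map O _ _).

Definition corr_act (X Y : C) n (s : 'S_n) (f : corr_set X Y n) :
    corr_set X Y n :=
  (idm Y ⊠ sqact E s) ∘ f
  ∘ (xpow_out P X n ∘ (idm X ⊠ tpow_act P s^-1) ∘ xpow_in P X n).

Lemma corr_act_pt X Y n (s : 'S_n) :
  corr_act s (pt : corr_set X Y n) = (pt : corr_set X Y n).
Proof. by rewrite /corr_act /= zero_mapl zero_mapr. Qed.

Definition corr_data (X Y : C) : SymSeqData PSetCat :=
  @MkSymSeqData PSetCat (corr_set X Y)
    (fun n s => @MkPmap _ _ (@corr_act X Y n s) (@corr_act_pt X Y n s)).

(* The three rightmost morphisms identify X ∧ P^(n + m) with (X ∧ P^n) ∧ P^m. *)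
Definition corr_mul (X Y Z : C) n m
    (f : corr_set X Y n) (g : corr_set Y Z m) : corr_set X Z (n + m) :=
  (idm Z ⊠ rmul E n m)
  ∘ (idm Z ⊠ msw (E m) (E n))
  ∘ massoc Z (E m) (E n)
  ∘ ((g ∘ xpow_out P Y m) ⊠ idm (E n))
  ∘ massoc' Y (tpow P m) (E n)
  ∘ (idm Y ⊠ msw (E n) (tpow P m))
  ∘ massoc Y (E n) (tpow P m)
  ∘ ((f ∘ xpow_out P X n) ⊠ idm (tpow P m))
  ∘ massoc' X (tpow P n) (tpow P m)
  ∘ (idm X ⊠ tpow_split P n m)
  ∘ xpow_in P X (n + m).

Definition corr_one (X : C) : corr_set X X 0 := (idm X ⊠ rone E) ∘ runit' X.

Variable B : C -> Prop.

Definition sub_prod (hB : forall X Y, B X -> B Y -> B (X ⊗ Y)) (X Y : full_ob B) :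
    full_ob B :=
  exist B (sval X ⊗ sval Y) (hB _ _ (svalP X) (svalP Y)).

Definition corr_is_symseq : Prop :=
  forall X Y : full_ob B, is_symseq (corr_data (sval X) (sval Y)).

Section Category.
Hypothesis hact : corr_is_symseq.

Definition corr_hom (X Y : full_ob B) : SymPSetMon := MkSymSeq (hact X Y).

Definition corr_vcat
    (comp : forall X Y Z, Hom (corr_hom X Y ⊗ corr_hom Y Z) (corr_hom X Z))
    (one : forall X, Hom munit (corr_hom X X)) : VCatData SymPSetMon :=
  @MkVCatData SymPSetMon (full_ob B) corr_hom comp one.

Definition comp_is_corr_mul
    (comp : forall X Y Z, Hom (corr_hom X Y ⊗ corr_hom Y Z) (corr_hom X Z)) :
    Prop :=
  forall (X Y Z : full_ob B) n m
    (f : corr_set (sval X) (sval Y) n) (g : corr_set (sval Y) (sval Z) m),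
    ap (comp X Y Z)
      (dmk (X := corr_hom X Y) (Y := corr_hom Y Z) erefl 1 f g)
    = corr_mul f g.

Definition one_is_corr_one (one : forall X, Hom munit (corr_hom X X)) : Prop :=
  forall X : full_ob B, ap (one X) dunit1 = corr_one (sval X).

End Category.

End Corr.

Arguments corr_is_symseq {C} O P E B.

(* Main.v *)
(** A correspondence of degree [n] is handled as a morphism
[X ⊗ P^n -> Y ⊗ E_n].  For arbitrary objects in place of [P^n] and [E_n], such
morphisms compose by [star], which is associative up to the associators.
Whiskering with [W] on the left involves associators only, and whiskering on the
right is its conjugate by the symmetry of [C]; the product of two
correspondences is the composite of a right and a left whiskering.  So the laws
of the product reduce to those of left whiskering, to the hexagon of [C] and to
one interchange law, [star_interchange], where the factors from [E] and [P] are
swapped: the swap is undone by [tpow_split_msw] for [P] and by commutativity for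
[E].  All the coherence conditions come from [C], along the functor sending [h]
to [h ⊗ ι], with [ι] the unit of [E]. *)

Require Import Defs.
From mathcomp Require Import all_boot all_fingroup.
From mathcomp Require Import zify.
From mathcomp Require Import boolp.
Import Defs.

Set Implicit Arguments.
Unset Strict Implicit.
Unset Printing Implicit Defensive.

Local Open Scope cat_scope.
#[local] Obligation Tactic := cbv beta.

Notation "A ◁ f" := (idm A ⊠ f) (at level 38, left associativity) : cat_scope.
Notation "f ▷ A" := (f ⊠ idm A) (at level 38, left associativity) : cat_scope.

(** Two bookkeeping problems shape the proof. First, [E (n + (m + k))] and [E (n + m + k)] are
    different objects, and so are the corresponding powers of [P]. Composition and whiskering are
    therefore studied for arbitrary objects, where only associators and swaps occur; degrees, casts
    and permutations enter with [kmul], once those laws are available. Second, an element of a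
    product of symmetric sequences carries a permutation label. Composites are kept with their
    labels ([cc]), so that each law splits into an identity between correspondences and an identity
    between permutations, which becomes arithmetic through [pval]. Commutativity of [E] enters
    through [cc_interchange], in the functoriality of the product and in the naturality of the
    symmetry. Naturality squares can be pasted along composition ([csquare_cc]), so the structure
    maps are treated one whiskered factor at a time. The permutation action on powers of [P] is
    defined by recursion, by inserting the first factor among the others; that it is multiplicative
    rests on the braid relation. *)

Section Chains.
Variable C : Cat.

(** Chains are normalised to the left by [compmA], where two adjacent factors need not form a
    subterm; this form rewrites them inside a chain. *)
Lemma compm_congl (X Y Z W : C) (g : Hom Y Z) (f : Hom X Y) (h : Hom X Z)
    (k : Hom Z W) : g ∘ f = h -> k ∘ g ∘ f = k ∘ h.
Proof. by move=> <-; rewrite compmA. Qed.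

End Chains.

Section Coherence.

(** * Consequences of the axioms of a symmetric monoidal category *)

Variable C : SymMonCat.
Implicit Types X Y Z W A B T U : C.

Lemma tens_compl A X Y Z (g : Hom Y Z) (f : Hom X Y) :
  A ◁ (g ∘ f) = (A ◁ g) ∘ (A ◁ f).
Proof. by rewrite -tensm_comp comp1m. Qed.

Lemma tens_compr A X Y Z (g : Hom Y Z) (f : Hom X Y) :
  (g ∘ f) ▷ A = (g ▷ A) ∘ (f ▷ A).
Proof. by rewrite -tensm_comp comp1m. Qed.

Lemma merge_l A X Y Z T (k : Hom (A ⊗ Z) T) (g : Hom Y Z) (f : Hom X Y) :
  k ∘ (A ◁ g) ∘ (A ◁ f) = k ∘ (A ◁ (g ∘ f)).
Proof. by rewrite tens_compl compmA. Qed.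

Lemma merge_r A X Y Z T (k : Hom (Z ⊗ A) T) (g : Hom Y Z) (f : Hom X Y) :
  k ∘ (g ▷ A) ∘ (f ▷ A) = k ∘ ((g ∘ f) ▷ A).
Proof. by rewrite tens_compr compmA. Qed.

Lemma tens_lr X X' Y Y' (f : Hom X X') (g : Hom Y Y') :
  (f ▷ Y') ∘ (X ◁ g) = f ⊠ g.
Proof. by rewrite -tensm_comp compm1 comp1m. Qed.

Lemma tens_rl X X' Y Y' (f : Hom X X') (g : Hom Y Y') :
  (X' ◁ g) ∘ (f ▷ Y) = f ⊠ g.
Proof. by rewrite -tensm_comp compm1 comp1m. Qed.

Lemma massocK1 X Y Z : massoc' X Y Z ∘ massoc X Y Z = idm _.
Proof. exact: (massocK X Y Z).1. Qed.
Lemma massocK2 X Y Z : massoc X Y Z ∘ massoc' X Y Z = idm _.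
Proof. exact: (massocK X Y Z).2. Qed.
Lemma lunitK1 X : lunit' X ∘ lunit X = idm _.
Proof. exact: (lunitK X).1. Qed.
Lemma lunitK2 X : lunit X ∘ lunit' X = idm _.
Proof. exact: (lunitK X).2. Qed.
Lemma runitK1 X : runit' X ∘ runit X = idm _.
Proof. exact: (runitK X).1. Qed.
Lemma runitK2 X : runit X ∘ runit' X = idm _.
Proof. exact: (runitK X).2. Qed.
Lemma msw_inv X Y : msw Y X ∘ msw X Y = idm _.
Proof. exact: (mswK X Y).1. Qed.

Lemma inverse_nat (D : Cat) (X X' Y Y' : D) (i : Hom X Y) (i' : Hom Y X)
    (j : Hom X' Y') (j' : Hom Y' X') (f : Hom X X') (g : Hom Y Y') :
  i ∘ i' = idm _ -> j' ∘ j = idm _ -> j ∘ f = g ∘ i -> j' ∘ g = f ∘ i'.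
Proof.
move=> iK jK E.
by rewrite -[LHS]compm1 -iK compmA (compm_congl _ (esym E)) compmA jK comp1m.
Qed.

Lemma massoc'_nat X X' Y Y' Z Z' (f : Hom X X') (g : Hom Y Y') (h : Hom Z Z') :
  massoc' X' Y' Z' ∘ (f ⊠ (g ⊠ h)) = ((f ⊠ g) ⊠ h) ∘ massoc' X Y Z.
Proof.
exact: inverse_nat (massocK2 _ _ _) (massocK1 _ _ _) (massoc_nat f g h).
Qed.

Lemma lunit'_nat X X' (f : Hom X X') : lunit' X' ∘ f = (munit ◁ f) ∘ lunit' X.
Proof. exact: inverse_nat (lunitK2 _) (lunitK1 _) (lunit_nat f). Qed.

Lemma cancel_r (D : Cat) (X Y Z : D) (i : Hom X Y) (i' : Hom Y X)
    (f g : Hom Y Z) : i ∘ i' = idm _ -> f ∘ i = g ∘ i -> f = g.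
Proof. by move=> iK E; rewrite -[f]compm1 -iK compmA E -compmA iK compm1. Qed.

Lemma cancel_l (D : Cat) (X Y Z : D) (i : Hom Y Z) (i' : Hom Z Y)
    (f g : Hom X Y) : i' ∘ i = idm _ -> i ∘ f = i ∘ g -> f = g.
Proof. by move=> iK E; rewrite -[f]comp1m -iK -compmA E compmA iK comp1m. Qed.

Lemma hexagon_sw X Y Z :
  massoc Y Z X ∘ msw X (Y ⊗ Z)
  = (Y ◁ msw X Z) ∘ massoc Y X Z ∘ (msw X Y ▷ Z) ∘ massoc' X Y Z.
Proof.
apply: cancel_r (massocK2 X Y Z) _.
by rewrite hexagon (compm_congl _ (massocK1 _ _ _)) compm1.
Qed.

(** The symmetry is its own inverse, so the two sides are the inverses of the two sides of
    [hexagon_sw Z X Y]. *)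
Lemma hexagon_sw' X Y Z :
  msw (X ⊗ Y) Z ∘ massoc' X Y Z
  = massoc Z X Y ∘ (msw X Z ▷ Y) ∘ massoc' X Z Y ∘ (X ◁ msw Y Z).
Proof.
have inv (D : Cat) (A B : D) (f g : Hom A B) (f' g' : Hom B A) :
    f' ∘ f = idm _ -> g ∘ g' = idm _ -> f' = g' -> f = g.
  by move=> fK gK E; rewrite -[f]comp1m -gK -E -compmA fK compm1.
apply: (inv _ _ _ _ _ _ _ _ _ (hexagon_sw Z X Y)).
  rewrite !compmA (compm_congl _ (msw_inv _ _)) compm1.
  exact: massocK2.
rewrite !compmA merge_l msw_inv tensm_id.
rewrite compm1 (compm_congl _ (massocK1 _ _ _)) compm1.
rewrite merge_r msw_inv tensm_id compm1.
exact: massocK2.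
Qed.

(** Two ways of reversing the order of three factors: naturality of the symmetry aligns them, and
    one hexagon of each kind finishes. This and its inverse [msw_past'] serve in [lwh_lwh]. *)
Lemma msw_past X B T :
  massoc X T B ∘ (msw T X ▷ B) ∘ msw B (T ⊗ X)
  = (X ◁ msw B T) ∘ msw (B ⊗ T) X ∘ massoc' B T X.
Proof.
rewrite (compm_congl _ (esym (msw_nat (idm B) (msw T X)))) compmA hexagon_sw.
by rewrite (compm_congl _ (hexagon_sw' _ _ _)) !compmA.
Qed.

Lemma msw_past' X B T :
  msw (T ⊗ X) B ∘ (msw X T ▷ B) ∘ massoc' X T B
  = massoc B T X ∘ msw X (B ⊗ T) ∘ (X ◁ msw T B).
Proof.
apply: (cancel_r (i := (X ◁ msw B T) ∘ msw (B ⊗ T) X ∘ massoc' B T X)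
  (i' := massoc B T X ∘ msw X (B ⊗ T) ∘ (X ◁ msw T B))).
  rewrite !compmA (compm_congl _ (massocK1 _ _ _)) compm1.
  rewrite (compm_congl _ (msw_inv _ _)) compm1 -tens_compl msw_inv.
  by rewrite tensm_id.
rewrite -[in LHS]msw_past !compmA (compm_congl _ (massocK1 _ _ _)) compm1.
rewrite merge_r msw_inv tensm_id compm1 msw_inv.
rewrite merge_l msw_inv tensm_id compm1.
by rewrite (compm_congl _ (msw_inv _ _)) compm1 massocK2.
Qed.

Lemma tens_munit_inj X Y (f g : Hom X Y) : munit ◁ f = munit ◁ g -> f = g.
Proof.
move=> E; apply: cancel_r (lunitK2 X) _.
by rewrite -!lunit_nat E.
Qed.

Lemma munit_tens_inj X Y (f g : Hom X Y) : f ▷ munit = g ▷ munit -> f = g.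
Proof.
move=> E; apply: cancel_r (runitK2 X) _.
by rewrite -!runit_nat E.
Qed.

(** Kelly's argument: after tensoring with the unit, which is faithful, the identity follows from
    the pentagon and the triangle. *)
Lemma massoc_tens_lunit A B : lunit (A ⊗ B) ∘ massoc munit A B = lunit A ▷ B.
Proof.
apply: tens_munit_inj; rewrite tens_compl.
have K : (massoc munit munit A ▷ B) ∘ (massoc' munit munit A ▷ B) = idm _.
  by rewrite -tens_compr massocK2 tensm_id.
apply: cancel_r (massocK2 _ _ _) _; apply: cancel_r K _.
rewrite -!compmA [X in _ ∘ X]compmA -pentagon compmA triangle.
rewrite [RHS]compmA -massoc_nat -compmA -tens_compr triangle.
by rewrite massoc_nat tensm_id.
Qed.

Lemma massoc_tens_runit A B : (A ◁ runit B) ∘ massoc A B munit = runit (A ⊗ B).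
Proof.
apply: munit_tens_inj; apply: cancel_l (massocK1 _ _ _) _.
rewrite tens_compr compmA massoc_nat -(triangle B munit) -triangle tens_compl.
rewrite -!compmA [X in _ ∘ X]compmA -pentagon compmA -massoc_nat tensm_id.
by rewrite -compmA.
Qed.

(** Composing the hexagon at [A], [munit], [munit] with a left unitor leaves the claim tensored with
    the unit, preceded on both sides by an invertible swap. *)
Lemma msw_lunit A : lunit A ∘ msw A munit = runit A.
Proof.
apply: munit_tens_inj.
have K : msw munit A ∘ msw A munit = idm _ by apply: msw_inv.
apply: cancel_l K _.
have E := congr1 (compm (lunit _)) (hexagon A munit munit).
move: E; rewrite !compmA lunit_nat (compm_congl _ (massoc_tens_lunit _ _)).
rewrite massoc_tens_lunit -msw_nat -compmA triangle => ->.
by rewrite tens_compr compmA.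
Qed.

Lemma msw_runit A : runit A ∘ msw munit A = lunit A.
Proof. by rewrite -msw_lunit -compmA msw_inv compm1. Qed.

Lemma msw_runit' A : msw A munit ∘ runit' A = lunit' A.
Proof.
apply: cancel_l (lunitK1 A) _.
by rewrite compmA msw_lunit runitK2 lunitK2.
Qed.

Lemma pentagon_l X Y Z W :
  massoc (X ⊗ Y) Z W ∘ (massoc' X Y Z ▷ W)
  = massoc' X Y (Z ⊗ W) ∘ (X ◁ massoc Y Z W) ∘ massoc X (Y ⊗ Z) W.
Proof.
have K : (massoc X Y Z ▷ W) ∘ (massoc' X Y Z ▷ W) = idm _.
  by rewrite -tens_compr massocK2 tensm_id.
apply: cancel_l (massocK1 _ _ _) _.
rewrite !compmA pentagon massocK2 comp1m.
by rewrite (compm_congl _ K) compm1.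
Qed.

Lemma pentagon_r X Y Z W :
  (massoc X Y Z ▷ W) ∘ massoc' (X ⊗ Y) Z W
  = massoc' X (Y ⊗ Z) W ∘ (X ◁ massoc' Y Z W) ∘ massoc X Y (Z ⊗ W).
Proof.
have K : (X ◁ massoc' Y Z W) ∘ (X ◁ massoc Y Z W) = idm _.
  by rewrite -tens_compl massocK1 tensm_id.
apply: cancel_r (massocK2 _ _ _) _.
rewrite (compm_congl _ (massocK1 _ _ _)) compm1 (compm_congl _ (pentagon _ _ _ _)).
rewrite !compmA (compm_congl _ K) compm1 massocK1.
by rewrite comp1m.
Qed.

Lemma pentagon_congl X Y Z W T (k : Hom (X ⊗ (Y ⊗ (Z ⊗ W))) T) :
  k ∘ (X ◁ massoc Y Z W) ∘ massoc X (Y ⊗ Z) W ∘ (massoc X Y Z ▷ W)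
  = k ∘ massoc X Y (Z ⊗ W) ∘ massoc (X ⊗ Y) Z W.
Proof. by rewrite -!compmA pentagon !compmA. Qed.

(** * Morphisms with a parameter on both sides *)

Section Whisker.

(* Sealed, so that unification does not find compositions inside. *)
Fact whisker_key : unit. Proof. by []. Qed.
Notation seal f := (locked_with whisker_key f).

(* [F] acting on the first two factors. *)
Definition rwh X Y A B (F : Hom (X ⊗ A) (Y ⊗ B)) T :
    Hom (X ⊗ (A ⊗ T)) (Y ⊗ (B ⊗ T)) :=
  seal (massoc Y B T ∘ (F ▷ T) ∘ massoc' X A T).

(* [G] acting on the first and third factors. *)
Definition lwh T X Y A B (G : Hom (X ⊗ A) (Y ⊗ B)) :
    Hom (X ⊗ (T ⊗ A)) (Y ⊗ (T ⊗ B)) :=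
  seal ((Y ◁ msw B T) ∘ rwh G T ∘ (X ◁ msw T A)).

(** While [F] acts, [A'] waits; while [G] acts, [B] waits. Keeping [B] to the left of [B'] builds
    the last swap of the pairing into [lwh], so that [rmul E n m] applies directly. *)
Definition star X Y Z A B A' B' (F : Hom (X ⊗ A) (Y ⊗ B))
    (G : Hom (Y ⊗ A') (Z ⊗ B')) : Hom (X ⊗ (A ⊗ A')) (Z ⊗ (B ⊗ B')) :=
  seal (lwh B G ∘ rwh F A').

Definition wl W X Y A B (F : Hom (X ⊗ A) (Y ⊗ B)) :
    Hom ((W ⊗ X) ⊗ A) ((W ⊗ Y) ⊗ B) :=
  seal (massoc' W Y B ∘ (W ◁ F) ∘ massoc W X A).

Definition wr W X Y A B (F : Hom (X ⊗ A) (Y ⊗ B)) :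
    Hom ((X ⊗ W) ⊗ A) ((Y ⊗ W) ⊗ B) :=
  seal ((msw W Y ▷ B) ∘ wl W F ∘ (msw X W ▷ A)).

Lemma rwhE X Y A B (F : Hom (X ⊗ A) (Y ⊗ B)) T :
  rwh F T = massoc Y B T ∘ (F ▷ T) ∘ massoc' X A T.
Proof. by rewrite /rwh unlock. Qed.

Lemma lwhE T X Y A B (G : Hom (X ⊗ A) (Y ⊗ B)) :
  lwh T G = (Y ◁ msw B T) ∘ rwh G T ∘ (X ◁ msw T A).
Proof. by rewrite /lwh unlock. Qed.

Lemma starE X Y Z A B A' B' (F : Hom (X ⊗ A) (Y ⊗ B))
    (G : Hom (Y ⊗ A') (Z ⊗ B')) : star F G = lwh B G ∘ rwh F A'.
Proof. by rewrite /star unlock. Qed.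

Lemma wlE W X Y A B (F : Hom (X ⊗ A) (Y ⊗ B)) :
  wl W F = massoc' W Y B ∘ (W ◁ F) ∘ massoc W X A.
Proof. by rewrite /wl unlock. Qed.

Lemma wrE W X Y A B (F : Hom (X ⊗ A) (Y ⊗ B)) :
  wr W F = (msw W Y ▷ B) ∘ wl W F ∘ (msw X W ▷ A).
Proof. by rewrite /wr unlock. Qed.

Lemma rwh_comp X Y Z A B D (F : Hom (X ⊗ A) (Y ⊗ B)) (G : Hom (Y ⊗ B) (Z ⊗ D)) T :
  rwh (G ∘ F) T = rwh G T ∘ rwh F T.
Proof.
by rewrite !rwhE tens_compr !compmA (compm_congl _ (massocK1 _ _ _)) compm1.
Qed.

Lemma rwh_tens X Y A B (h : Hom X Y) (k : Hom A B) T :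
  rwh (h ⊠ k) T = h ⊠ (k ▷ T).
Proof.
by rewrite !rwhE massoc_nat (compm_congl _ (massocK2 _ _ _)) compm1.
Qed.

Lemma rwh_nat X Y A B (F : Hom (X ⊗ A) (Y ⊗ B)) T T' (t : Hom T T') :
  rwh F T' ∘ (X ◁ (A ◁ t)) = (Y ◁ (B ◁ t)) ∘ rwh F T.
Proof.
rewrite !rwhE (compm_congl _ (massoc'_nat _ _ _)) !tensm_id !compmA -massoc_nat.
by rewrite tensm_id (compm_congl _ (tens_lr _ _)) (compm_congl _ (tens_rl _ _)).
Qed.

Lemma rwh_rwh X Y A B (F : Hom (X ⊗ A) (Y ⊗ B)) T U :
  rwh (rwh F T) U = (Y ◁ massoc' B T U) ∘ rwh F (T ⊗ U) ∘ (X ◁ massoc A T U).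
Proof.
have KY : (Y ◁ massoc' B T U) ∘ (Y ◁ massoc B T U) = idm _.
  by rewrite -tens_compl massocK1 tensm_id.
have KX : (massoc X A T ▷ U) ∘ (massoc' X A T ▷ U) = idm _.
  by rewrite -tens_compr massocK2 tensm_id.
apply: cancel_r (massocK2 _ _ _) _; apply: cancel_r KX _.
rewrite !rwhE !tens_compr !compmA (compm_congl _ (massocK1 _ _ _)) compm1.
have KX' : (massoc' X A T ▷ U) ∘ (massoc X A T ▷ U) = idm _.
  by rewrite -tens_compr massocK1 tensm_id.
rewrite (compm_congl _ KX') compm1.
rewrite pentagon_congl (compm_congl _ (massocK1 _ _ _)) compm1.
rewrite -(tensm_id T U) (compm_congl _ (esym (massoc_nat _ _ _))).
rewrite !compmA (compm_congl _ (pentagon _ _ _ _)) !compmA KY comp1m.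
by [].
Qed.

Lemma wl_comp W X Y Z A B D (F : Hom (X ⊗ A) (Y ⊗ B)) (G : Hom (Y ⊗ B) (Z ⊗ D)) :
  wl W (G ∘ F) = wl W G ∘ wl W F.
Proof.
by rewrite !wlE tens_compl !compmA (compm_congl _ (massocK2 _ _ _)) compm1.
Qed.

Lemma wl_tens W X Y A B (h : Hom X Y) (k : Hom A B) :
  wl W (h ⊠ k) = (W ◁ h) ⊠ k.
Proof.
by rewrite !wlE massoc'_nat (compm_congl _ (massocK1 _ _ _)) compm1.
Qed.

Lemma wl_nat W W' (w : Hom W W') X Y A B (F : Hom (X ⊗ A) (Y ⊗ B)) :
  wl W' F ∘ ((w ▷ X) ▷ A) = ((w ▷ Y) ▷ B) ∘ wl W F.
Proof.
rewrite !wlE (compm_congl _ (massoc_nat _ _ _)) !tensm_id !compmA -massoc'_nat.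
by rewrite tensm_id (compm_congl _ (tens_lr _ _)) (compm_congl _ (tens_rl _ _)).
Qed.

(** Whiskering adds a factor on the far left and [rwh] one on the far right, so two rearranged
    pentagons identify both orders. *)
Lemma wl_rwh W X Y A B (F : Hom (X ⊗ A) (Y ⊗ B)) T :
  rwh (wl W F) T = wl W (rwh F T).
Proof.
rewrite !rwhE !wlE !tens_compr !tens_compl !compmA pentagon_l.
rewrite (compm_congl _ (pentagon_r _ _ _ _)) !compmA.
rewrite (compm_congl _ (massoc_nat _ _ _)) !compmA.
by rewrite (compm_congl _ (massocK2 _ _ _)) compm1.
Qed.

Lemma wl_lwh W X Y A B (G : Hom (X ⊗ A) (Y ⊗ B)) T :
  lwh T (wl W G) = wl W (lwh T G).
Proof. by rewrite !lwhE wl_rwh !wl_comp !wl_tens !tensm_id. Qed.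

Lemma wl_star W X Y Z A B A' B' (F : Hom (X ⊗ A) (Y ⊗ B))
    (G : Hom (Y ⊗ A') (Z ⊗ B')) :
  wl W (star F G) = star (wl W F) (wl W G).
Proof. by rewrite !starE wl_comp wl_lwh wl_rwh. Qed.

Lemma wl_wl V W X Y A B (F : Hom (X ⊗ A) (Y ⊗ B)) :
  (massoc V W Y ▷ B) ∘ wl (V ⊗ W) F = wl V (wl W F) ∘ (massoc V W X ▷ A).
Proof.
rewrite !wlE !compmA pentagon_r !tens_compl !compmA.
rewrite pentagon_congl -[idm (V ⊗ W)]tensm_id.
by rewrite (compm_congl _ (massoc_nat _ _ _)) !compmA.
Qed.

Lemma wl_munit X Y A B (F : Hom (X ⊗ A) (Y ⊗ B)) :
  (lunit Y ▷ B) ∘ wl munit F = F ∘ (lunit X ▷ A).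
Proof.
rewrite !wlE !compmA -massoc_tens_lunit (compm_congl _ (massocK2 _ _ _)) compm1.
by rewrite lunit_nat -compmA massoc_tens_lunit.
Qed.

Lemma lwh_comp X Y Z A B D (F : Hom (X ⊗ A) (Y ⊗ B)) (G : Hom (Y ⊗ B) (Z ⊗ D)) T :
  lwh T (G ∘ F) = lwh T G ∘ lwh T F.
Proof.
rewrite !lwhE rwh_comp !compmA merge_l.
by rewrite msw_inv tensm_id compm1.
Qed.

Lemma lwh_tens X Y A B (h : Hom X Y) (k : Hom A B) T :
  lwh T (h ⊠ k) = h ⊠ (T ◁ k).
Proof.
rewrite !lwhE rwh_tens -!tensm_comp comp1m compm1 msw_nat -compmA msw_inv.
by rewrite compm1.
Qed.

Lemma lwh_nat X Y A B (F : Hom (X ⊗ A) (Y ⊗ B)) T T' (t : Hom T T') :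
  lwh T' F ∘ (X ◁ (t ▷ A)) = (Y ◁ (t ▷ B)) ∘ lwh T F.
Proof.
rewrite !lwhE merge_l msw_nat tens_compl compmA.
by rewrite (compm_congl _ (rwh_nat _ _)) !compmA -!tens_compl msw_nat.
Qed.

Lemma lwh_lwh X Y A B (G : Hom (X ⊗ A) (Y ⊗ B)) T U :
  (Y ◁ massoc T U B) ∘ lwh (T ⊗ U) G = lwh T (lwh U G) ∘ (X ◁ massoc T U A).
Proof.
rewrite !lwhE !rwh_comp !rwh_tens rwh_rwh !compmA.
rewrite -!tens_compl !merge_l !compmA.
rewrite msw_past (compm_congl _ (massocK1 _ _ _)) compm1 (tens_compl X (A ◁ _)).
rewrite compmA (compm_congl _ (rwh_nat _ _)) !compmA -tens_compl.
by rewrite msw_past' merge_l msw_inv tensm_id compm1.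
Qed.

Lemma lwh_rwh X Y A B (G : Hom (X ⊗ A) (Y ⊗ B)) T U :
  (Y ◁ massoc T B U) ∘ rwh (lwh T G) U = lwh T (rwh G U) ∘ (X ◁ massoc T A U).
Proof.
rewrite !lwhE !rwh_comp !rwh_tens !rwh_rwh !compmA.
rewrite -!tens_compl !merge_l !compmA.
rewrite hexagon_sw (compm_congl _ (massocK1 _ _ _)) compm1.
rewrite -!compmA (tens_compl X (A ◁ _)) !compmA.
rewrite (compm_congl _ (rwh_nat _ _)) !compmA -tens_compl.
by rewrite hexagon_sw' merge_l msw_inv tensm_id compm1.
Qed.

(** Both sides are [F], then [G], then [H], each with two idle factors. Only the bracketing of these
    differs, and [rwh_rwh], [lwh_rwh] and [lwh_lwh] each rebracket one stage. *)
Lemma star_assoc X Y Z W A B A' B' A'' B'' (F : Hom (X ⊗ A) (Y ⊗ B))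
    (G : Hom (Y ⊗ A') (Z ⊗ B')) (H : Hom (Z ⊗ A'') (W ⊗ B'')) :
  (W ◁ massoc B B' B'') ∘ star (star F G) H
  = star F (star G H) ∘ (X ◁ massoc A A' A'').
Proof.
have K : (Y ◁ massoc B A' A'') ∘ (Y ◁ massoc' B A' A'') = idm _.
  by rewrite -tens_compl massocK2 tensm_id.
rewrite !starE rwh_comp lwh_comp !compmA lwh_lwh (compm_congl _ (lwh_rwh _ _ _)).
by rewrite rwh_rwh !compmA (compm_congl _ K) compm1.
Qed.

Lemma star_nat X Y Z A B A' B' A1 B1 A1' B1' (F : Hom (X ⊗ A) (Y ⊗ B))
    (G : Hom (Y ⊗ A') (Z ⊗ B')) (a : Hom A1 A) (b : Hom B B1)
    (a' : Hom A1' A') (b' : Hom B' B1') :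
  star ((Y ◁ b) ∘ F ∘ (X ◁ a)) ((Z ◁ b') ∘ G ∘ (Y ◁ a'))
  = (Z ◁ (b ⊠ b')) ∘ star F G ∘ (X ◁ (a ⊠ a')).
Proof.
rewrite !starE !lwh_comp !rwh_comp !lwh_tens !rwh_tens !compmA.
rewrite merge_l tens_rl -(tens_lr b a') tens_compl compmA.
rewrite (compm_congl _ (lwh_nat _ _)) (compm_congl _ (esym (rwh_nat _ _))).
by rewrite !compmA merge_l tens_rl -tens_compl tens_rl.
Qed.

Lemma rwh_munit X Y A B (F : Hom (X ⊗ A) (Y ⊗ B)) :
  rwh F munit = (Y ◁ runit' B) ∘ F ∘ (X ◁ runit A).
Proof.
have KY : (Y ◁ runit B) ∘ (Y ◁ runit' B) = idm _.
  by rewrite -tens_compl runitK2 tensm_id.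
have KY' : (Y ◁ runit' B) ∘ (Y ◁ runit B) = idm _.
  by rewrite -tens_compl runitK1 tensm_id.
apply: cancel_l KY' _; rewrite !compmA KY comp1m.
rewrite !rwhE !compmA massoc_tens_runit runit_nat -massoc_tens_runit.
by rewrite !compmA (compm_congl _ (massocK2 _ _ _)) compm1.
Qed.

Lemma lwh_munit X Y A B (F : Hom (X ⊗ A) (Y ⊗ B)) :
  lwh munit F = (Y ◁ lunit' B) ∘ F ∘ (X ◁ lunit A).
Proof.
rewrite !lwhE rwh_munit !compmA -tens_compl msw_runit'.
by rewrite merge_l msw_runit.
Qed.

Lemma star_unitl X Y Z A B B0 (h : Hom X Y) (e : Hom munit B0)
    (G : Hom (Y ⊗ A) (Z ⊗ B)) :
  star (h ⊠ e) G = (Z ◁ ((e ▷ B) ∘ lunit' B)) ∘ G ∘ (h ⊠ lunit A).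
Proof.
rewrite !starE rwh_tens -tens_rl compmA lwh_nat lwh_munit.
rewrite !compmA -tens_compl (compm_congl _ (tens_rl _ _)).
by [].
Qed.

Lemma star_unitr X Y Z A B B0 (F : Hom (X ⊗ A) (Y ⊗ B)) (h : Hom Y Z)
    (e : Hom munit B0) :
  star F (h ⊠ e) = (h ⊠ ((B ◁ e) ∘ runit' B)) ∘ F ∘ (X ◁ runit A).
Proof.
rewrite !starE lwh_tens rwh_munit !compmA -tensm_comp.
by rewrite compm1.
Qed.

(** * Middle-four interchange *)

(** Sorts the factors so that a right and a left whiskering become plain tensoring with identities
    on disjoint factors ([mid_rwh], [mid_lwh]), where bifunctoriality lets them commute. *)
Definition mid X Y A D : Hom ((X ⊗ Y) ⊗ (A ⊗ D)) ((X ⊗ A) ⊗ (Y ⊗ D)) :=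
  massoc' X A (Y ⊗ D) ∘ (X ◁ (massoc A Y D ∘ (msw Y A ▷ D) ∘ massoc' Y A D))
  ∘ massoc X Y (A ⊗ D).

Lemma mid_inv X Y A D : mid X A Y D ∘ mid X Y A D = idm _.
Proof.
rewrite /mid !compmA (compm_congl _ (massocK2 _ _ _)) compm1.
rewrite merge_l !compmA.
rewrite (compm_congl _ (massocK1 _ _ _)) compm1.
rewrite merge_r msw_inv tensm_id compm1.
by rewrite massocK2 tensm_id compm1 massocK1.
Qed.

Lemma mid_lwh X Y Y' A A' B' (G : Hom (Y ⊗ A') (Y' ⊗ B')) :
  mid X Y' A B' ∘ lwh A (wl X G) = ((X ⊗ A) ◁ G) ∘ mid X Y A A'.
Proof.
have ex (Z D : C) : massoc A Z D ∘ (msw Z A ▷ D) ∘ massoc' Z A D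
    = msw (Z ⊗ D) A ∘ massoc' Z D A ∘ (Z ◁ msw A D).
  rewrite hexagon_sw' merge_l msw_inv tensm_id.
  by rewrite compm1.
rewrite wl_lwh /mid !wlE !compmA (compm_congl _ (massocK2 _ _ _)) compm1 !ex.
rewrite merge_l -tensm_id -massoc'_nat.
rewrite merge_l !lwhE !rwhE.
congr (_ ∘ (_ ◁ _) ∘ _); rewrite !compmA -msw_nat.
rewrite merge_l msw_inv tensm_id compm1.
by rewrite (compm_congl _ (massocK1 _ _ _)) compm1.
Qed.

Lemma mid_rwh X Y X' A B D (F : Hom (X ⊗ A) (X' ⊗ B)) :
  mid X' Y B D ∘ rwh (wr Y F) D = (F ▷ (Y ⊗ D)) ∘ mid X Y A D.
Proof.
(* [e] exchanges [Y] and [A] behind [X]. Written through swaps ([eE]) it cancels those in [wr], and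
   [mid] is [e] with [D] carried along ([midE]). *)
pose e X A := massoc' X A Y ∘ (X ◁ msw Y A) ∘ massoc X Y A.
have eE U V : e U V = msw Y (U ⊗ V) ∘ massoc Y U V ∘ (msw U Y ▷ V).
  apply: cancel_l (massocK1 _ _ _) _; rewrite /e !compmA hexagon_sw.
  rewrite massocK2 comp1m (compm_congl _ (massocK1 _ _ _)) compm1.
  by rewrite merge_r msw_inv tensm_id compm1.
have midE U V : mid U Y V D = massoc (U ⊗ V) Y D ∘ (e U V ▷ D) ∘ massoc' (U ⊗ Y) V D.
  rewrite /e !tens_compr !compmA pentagon_l (compm_congl _ (pentagon_r _ _ _ _)).
  rewrite !compmA (compm_congl _ (massoc_nat _ _ _)) !compmA.
  rewrite (compm_congl _ (massocK2 _ _ _)) compm1 /mid.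
  by rewrite !tens_compl !compmA.
have eF : e X' B ∘ wr Y F = (F ▷ Y) ∘ e X A.
  rewrite !eE !wrE !wlE !compmA merge_r.
  rewrite msw_inv tensm_id compm1 (compm_congl _ (massocK2 _ _ _)) compm1.
  by rewrite msw_nat.
rewrite !midE !rwhE !compmA (compm_congl _ (massocK1 _ _ _)) compm1.
rewrite merge_r eF tens_compr compmA.
by rewrite massoc_nat tensm_id.
Qed.

Lemma star_interchange X X' Y Y' A A' B B' (F : Hom (X ⊗ A) (X' ⊗ B))
    (G : Hom (Y ⊗ A') (Y' ⊗ B')) :
  star (wr Y F) (wl X' G)
  = (idm (X' ⊗ Y') ⊠ msw B' B) ∘ star (wl X G) (wr Y' F)
    ∘ (idm (X ⊗ Y) ⊠ msw A A').
Proof.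
rewrite !starE (lwhE B' (wr Y' F)) !compmA -tens_compl msw_inv tensm_id comp1m.
(* The outer swaps absorb those inside [lwh]; what remains is that a [lwh] and a [rwh] commute,
   which is visible after [mid]. *)
have -> : rwh (wr Y' F) B' ∘ (idm (X ⊗ Y') ⊠ msw B' A) ∘ rwh (wl X G) A
      ∘ (idm (X ⊗ Y) ⊠ msw A A')
    = rwh (wr Y' F) B' ∘ lwh A (wl X G) by rewrite lwhE !compmA.
apply: cancel_l (mid_inv _ _ _ _) _; rewrite !compmA mid_lwh mid_rwh.
rewrite (compm_congl _ (mid_rwh _ _ _)) (compm_congl _ (mid_lwh _ _ _)) !compmA.
by rewrite tens_lr tens_rl.
Qed.

End Whisker.

(** * Coherence of units and the braid relation *)

Lemma inverse_uniq (D : Cat) (X Y : D) (f : Hom X Y) (g g' : Hom Y X) :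
  g ∘ f = idm _ -> f ∘ g' = idm _ -> g = g'.
Proof. by move=> gK fK; rewrite -[g]compm1 -fK compmA gK comp1m. Qed.

Lemma lunit_munit : lunit (munit : C) = runit munit.
Proof.
apply: munit_tens_inj; rewrite -triangle -massoc_tens_lunit.
congr (_ ∘ _); apply: cancel_l (lunitK1 _) _.
by rewrite lunit_nat.
Qed.

Lemma lunit'_munit : lunit' (munit : C) = runit' munit.
Proof.
by apply: inverse_uniq (lunitK1 _) _; rewrite lunit_munit runitK2.
Qed.

Lemma massoc_lunit' A B : massoc munit A B ∘ (lunit' A ▷ B) = lunit' (A ⊗ B).
Proof.
apply: cancel_l (lunitK1 _) _; rewrite compmA massoc_tens_lunit lunitK2.
by rewrite -tens_compr lunitK2 tensm_id.
Qed.

Lemma massoc'_runit' A B : massoc' A B munit ∘ (A ◁ runit' B) = runit' (A ⊗ B).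
Proof.
apply: cancel_l (runitK1 _) _; rewrite runitK2 compmA -massoc_tens_runit.
by rewrite (compm_congl _ (massocK2 _ _ _)) compm1 -tens_compl runitK2 tensm_id.
Qed.

Lemma triangle' X Y : massoc' X munit Y ∘ (X ◁ lunit' Y) = runit' X ▷ Y.
Proof.
have K : (runit' X ▷ Y) ∘ (runit X ▷ Y) = idm _.
  by rewrite -tens_compr runitK1 tensm_id.
apply: cancel_l K _; rewrite -[RHS]tens_compr runitK2 tensm_id compmA -triangle.
by rewrite (compm_congl _ (massocK2 _ _ _)) compm1 -tens_compl lunitK2 tensm_id.
Qed.

Lemma pentagon' X Y Z W :
  (massoc' X Y Z ▷ W) ∘ massoc' X (Y ⊗ Z) W ∘ (X ◁ massoc' Y Z W)
  = massoc' (X ⊗ Y) Z W ∘ massoc' X Y (Z ⊗ W).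
Proof.
apply: (inverse_uniq (f := massoc X Y (Z ⊗ W) ∘ massoc (X ⊗ Y) Z W)).
  rewrite pentagon !compmA merge_l massocK1 tensm_id compm1.
  by rewrite (compm_congl _ (massocK1 _ _ _)) compm1 -tens_compr massocK1 tensm_id.
by rewrite !compmA (compm_congl _ (massocK2 _ _ _)) compm1 massocK2.
Qed.

(* The transposition of two factors in front of [T] is [rwh (msw A B) T]. *)
Lemma transp_inv A B T : rwh (msw B A) T ∘ rwh (msw A B) T = idm _.
Proof. by rewrite -rwh_comp msw_inv -tensm_id rwh_tens !tensm_id. Qed.

Lemma transp_hexagon A B D T :
  massoc B D (A ⊗ T) ∘ rwh (msw A (B ⊗ D)) T ∘ (A ◁ massoc' B D T)
  = (B ◁ rwh (msw A D) T) ∘ rwh (msw A B) (D ⊗ T).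
Proof.
rewrite !rwhE !compmA pentagon.
rewrite -[_ ∘ (massoc B D A ▷ T) ∘ _]compmA -tens_compr hexagon_sw !tens_compr !compmA.
rewrite (compm_congl _ (massoc_nat _ _ _)) !compmA -tens_compl.
rewrite -!compmA [X in _ ∘ (_ ∘ (_ ∘ (_ ∘ X)))]compmA pentagon'.
rewrite !compmA (compm_congl _ (esym (massoc'_nat _ _ _))) tensm_id !compmA.
rewrite (compm_congl _ (pentagon_r _ _ _ _)) !compmA.
by rewrite (compm_congl _ (massocK2 _ _ _)) compm1 -tens_compl.
Qed.

(** The Yang-Baxter equation: by [transp_hexagon] both sides move [A] past a product of [B] and [D]
    in one swap, and naturality of that swap lets [B] and [D] be exchanged before or after it. *)
Lemma braid A B D T :
  rwh (msw B D) (A ⊗ T) ∘ (B ◁ rwh (msw A D) T) ∘ rwh (msw A B) (D ⊗ T)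
  = (D ◁ rwh (msw A B) T) ∘ rwh (msw A D) (B ⊗ T) ∘ (A ◁ rwh (msw B D) T).
Proof.
rewrite -compmA -!transp_hexagon (rwhE (msw B D)) !compmA.
rewrite (compm_congl _ (massocK1 _ _ _)) compm1.
have E : (msw B D ▷ (A ⊗ T)) ∘ rwh (msw A (B ⊗ D)) T
    = rwh (msw A (D ⊗ B)) T ∘ (A ◁ (msw B D ▷ T)).
  by rewrite -(tensm_id A T) -!rwh_tens -!rwh_comp msw_nat.
rewrite (compm_congl _ E) !compmA (rwhE (msw B D) T) -!compmA -!tens_compl !compmA.
by rewrite massocK1 comp1m.
Qed.

End Coherence.

(** * The action on tensor powers *)

Section PermDelete.
Variables (n : nat).

Lemma pval_lift (s : 'S_n.+1) i :
  pval s i.+1 = bump (pval s 0) (pval (perm_tail s) i).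
Proof.
rewrite (pval_ord s ord0); case: (ltnP i n) => h.
  rewrite (pval_ord _ (Ordinal h)) -[RHS]/(nat_of_ord (lift _ _)) permE.
  by rewrite -perm_tail_funP -pval_ord.
(* Out of range [pval] is the identity; the image of 0 is at most [n], so [bump] still adds one. *)
rewrite !pval_out // /bump; have := ltn_ord (s ord0); lia.
Qed.

Lemma pval_tail (s : 'S_n.+1) i :
  pval (perm_tail s) i = unbump (pval s 0) (pval s i.+1).
Proof. by rewrite pval_lift bumpK. Qed.

Lemma pval_injective (t : 'S_n) : injective (pval t).
Proof. by apply: (can_inj (g := pval t^-1)) => i; rewrite -pvalM mulgV pval1. Qed.

(* [t] without the position [k] and its image. *)
Lemma perm_delete (t : 'S_n.+1) k : k < n.+1 ->
  exists u : 'S_n, forall i, pval u i = unbump (pval t k) (pval t (bump k i)).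
Proof.
(* [c] sends 0 to [k] and is increasing elsewhere, so removing 0 and its image from [c * t] removes
   [k] and its image from [t]. *)
move=> h; pose c : 'S_n.+1 := lift_perm ord0 (Ordinal h) 1%g.
have c0 : pval c 0 = k by rewrite (pval_ord c ord0) lift_perm_id.
exists (perm_tail (c * t)%g) => i; rewrite pval_tail !pvalM c0; congr (unbump _ (pval _ _)).
case: (ltnP i n) => hi.
  rewrite -[i.+1]/(bump 0 (Ordinal hi)) -[bump 0 _]/(nat_of_ord (lift ord0 (Ordinal hi))).
  by rewrite pval_ord lift_perm_lift perm1.
by rewrite pval_out /bump; lia.
Qed.

End PermDelete.

Section TensorPowers.
Variables (C : SymMonCat) (P : C).
Notation pw := (tpow P).

Lemma tpow_ins0 n : tpow_ins P n 0 = idm _.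
Proof. by case: n. Qed.

Lemma tpow_insS n k : tpow_ins P n.+1 k.+1
  = (P ◁ tpow_ins P n k) ∘ rwh (msw P P) (pw n).
Proof. by rewrite rwhE. Qed.

Lemma tpow_actS n (s : 'S_n.+1) :
  tpow_act P s = tpow_ins P n (pval s 0) ∘ (P ◁ tpow_act P (perm_tail s)).
Proof. by rewrite (pval_ord s ord0). Qed.

(** Two factors are inserted in either order. On the left the second goes to [j'] and then the first
    to [j], which pushes the second to [bump j j']; on the right the second is inserted last. When
    both positions are successors, the three leading factors are rearranged by [braid]. *)
Lemma tpow_ins_ins n j j' : j' <= n ->
  tpow_ins P n.+1 j ∘ (P ◁ tpow_ins P n j') ∘ rwh (msw P P) (pw n)
  = tpow_ins P n.+1 (bump j j') ∘ (P ◁ tpow_ins P n (unbump (bump j j') j)).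
Proof.
elim: n j j' => [|n IH] [|j] j' hj.
- move: hj; rewrite leqn0 => /eqP ->; rewrite -[bump 0 0]/1 tpow_insS !tpow_ins0.
  by rewrite !tensm_id !comp1m compm1.
- move: hj; rewrite leqn0 => /eqP ->; rewrite -[bump j.+1 0]/0 tpow_insS.
  by rewrite !tpow_ins0 !tensm_id compm1 comp1m transp_inv compm1.
- rewrite -[bump 0 j']/j'.+1 (tpow_insS n.+1) !tpow_ins0.
  by rewrite tensm_id comp1m compm1.
case: j' hj => [|j'] hj.
  rewrite tpow_insS !tpow_ins0 tensm_id compm1 -compmA transp_inv compm1.
  by rewrite comp1m (_ : unbump _ _ = j) // /unbump /= subn1.
have -> : bump j.+1 j'.+1 = (bump j j').+1 by rewrite bumpS.
have -> : unbump (bump j j').+1 j.+1 = (unbump (bump j j') j).+1.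
  by rewrite /unbump ltnS; lia.
rewrite !(tpow_insS n.+1) !(tpow_insS n) !tens_compl !compmA.
rewrite (compm_congl _ (rwh_nat _ _)) !compmA.
rewrite -[LHS]compmA -[LHS]compmA [X in _ ∘ X]compmA (braid P P P (pw n)) !compmA -!tens_compl IH //.
by rewrite tens_compl (compm_congl _ (rwh_nat _ _)) compmA.
Qed.

(** What makes the recursive action multiplicative: an insertion passes through a permutation, which
    then acts on the other factors with [k] deleted. *)
Lemma tpow_act_ins n (t : 'S_n.+1) k (u : 'S_n) : k <= n ->
  (forall i, pval u i = unbump (pval t k) (pval t (bump k i))) ->
  tpow_act P t ∘ tpow_ins P n k = tpow_ins P n (pval t k) ∘ (P ◁ tpow_act P u).
Proof.
elim: n t k u => [|n IH] t [|k] u // hk uE.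
- rewrite tpow_ins0 compm1 tpow_actS; congr (_ ∘ (_ ◁ _)).
- rewrite tpow_ins0 compm1 tpow_actS; congr (_ ∘ (_ ◁ tpow_act _ _)).
  by apply: pval_inj => i; rewrite uE pval_tail.
rewrite tpow_actS tpow_insS !compmA merge_l.
have [u' u'E] := perm_delete (perm_tail t) hk.
have hk' : pval (perm_tail t) k <= n by rewrite -ltnS pval_lt.
rewrite (IH _ _ u') // tens_compl compmA (compm_congl _ (esym (rwh_nat _ _))) !compmA.
rewrite tpow_ins_ins // pval_lift -compmA -tens_compl (tpow_actS u) uE /=.
rewrite !pval_lift; congr (_ ∘ (_ ◁ (_ ∘ (_ ◁ tpow_act _ _)))).
apply: pval_inj => i; rewrite pval_tail !uE u'E !pval_lift bumpS.
rewrite -[bump k.+1 0]/0 pval_lift.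
have : pval (perm_tail t) (bump k i) != pval (perm_tail t) k.
  by rewrite (inj_eq (@pval_injective _ _)) eq_sym neq_bump.
rewrite /bump /unbump; lia.
Qed.

Lemma tpow_act1 n : tpow_act P (1 : 'S_n) = idm _.
Proof.
elim: n => // n IH; rewrite tpow_actS pval1 tpow_ins0 comp1m.
have -> : perm_tail (1 : 'S_n.+1) = 1%g; last by rewrite IH tensm_id.
by apply: pval_inj => i; rewrite pval_tail !pval1 /unbump /=; lia.
Qed.

Lemma tpow_actM n (s t : 'S_n) : tpow_act P (s * t) = tpow_act P t ∘ tpow_act P s.
Proof.
elim: n s t => [|n IH] s t; first by rewrite comp1m.
have h : pval s 0 < n.+1 by rewrite pval_lt.
have [u uE] := perm_delete t h.
rewrite (tpow_actS (s * t)) (tpow_actS s) compmA (tpow_act_ins _ uE) //.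
rewrite -compmA -tens_compl -IH pvalM; congr (_ ∘ (_ ◁ tpow_act _ _)).
by apply: pval_inj => i; rewrite pvalM uE pval_tail !pvalM -pval_lift.
Qed.

Lemma tpow_split_ins n m k : k <= n ->
  tpow_split P n.+1 m ∘ tpow_ins P (n + m) k
  = (tpow_ins P n k ▷ pw m) ∘ tpow_split P n.+1 m.
Proof.
elim: n k => [|n IH] [|k] hk //.
- by rewrite !tpow_ins0 tensm_id comp1m compm1.
- by rewrite !tpow_ins0 tensm_id comp1m compm1.
rewrite [tpow_ins P (n.+1 + m) _](tpow_insS (n + m)) tpow_insS [tpow_split _ _ _]/= -!compmA [X in _ ∘ X]compmA.
rewrite -tens_compl [X in P ◁ X]IH //.
have E : massoc' P (P ⊗ pw n) (pw m) ∘ (P ◁ massoc' P (pw n) (pw m))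
      ∘ rwh (msw P P) (pw n ⊗ pw m)
    = (rwh (msw P P) (pw n) ▷ pw m) ∘ massoc' P (P ⊗ pw n) (pw m)
      ∘ (P ◁ massoc' P (pw n) (pw m)).
  have K : (P ◁ massoc P (pw n) (pw m)) ∘ (P ◁ massoc' P (pw n) (pw m)) = idm _.
    by rewrite -tens_compl massocK2 tensm_id.
  rewrite -[LHS]compm1 -K !compmA; congr (_ ∘ _).
  rewrite -2!compmA [X in _ ∘ X]compmA -rwh_rwh (rwhE (rwh _ _)) !compmA.
  by rewrite massocK1 comp1m.
rewrite !tens_compl tens_compr -!compmA -rwh_nat.
rewrite [in RHS](compmA (massoc' _ _ _)) [in RHS](compmA (rwh _ _ ▷ _)).
rewrite [in RHS](compmA (rwh _ _ ▷ _)) -E -!compmA.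
rewrite [in LHS](compmA (massoc' _ _ _)) massoc'_nat.
by rewrite -!compmA.
Qed.

Lemma perm_S0 (s : 'S_0) : s = 1%g.
Proof. by apply/permP => -[]. Qed.

Lemma tpow_split_psum n m (s : 'S_n) (t : 'S_m) :
  tpow_split P n m ∘ tpow_act P (psum s t)
  = (tpow_act P s ⊠ tpow_act P t) ∘ tpow_split P n m.
Proof.
elim: n s => [|n IH] s.
  have -> : psum s t = t by apply: pval_inj => i; rewrite pval_psum /= subn0.
  by rewrite /= lunit'_nat.
have V i : pval (psum s t : 'S_(n + m).+1) i
    = if i < n.+1 then pval s i else n.+1 + pval t (i - n.+1).
  exact: (@pval_psum n.+1).
have E : perm_tail (psum s t : 'S_(n + m).+1) = psum (perm_tail s) t.
  apply: pval_inj => i; rewrite pval_tail !V pval_psum pval_tail !ltnS /= subSS.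
  have := pval_lt s 0; rewrite !ltnS; case: (ltnP i n) => // h h0; rewrite /unbump; lia.
have h0 : pval s 0 <= n by rewrite -ltnS pval_lt.
rewrite (tpow_actS (psum s t : 'S_(n + m).+1)) E V /= compmA.
rewrite [X in X ∘ _](tpow_split_ins _ h0) /= -(pval_ord s ord0) !compmA.
rewrite !merge_l IH -[tpow_act P t in RHS]comp1m tensm_comp tens_compl.
by rewrite compmA !(compm_congl _ (massoc'_nat _ _ _)) !compmA.
Qed.

(** * Splitting of tensor powers: associativity, unit and symmetry *)

Lemma sqcast_tpowS n m (e : n.+1 = m.+1) (e' : n = m) :
  sqcast pw e = P ◁ sqcast pw e'.
Proof. by case: m / e' e => e; rewrite (eq_irrelevance e erefl) /= tensm_id. Qed.

Lemma sqcast_id (D : Cat) (F : nat -> D) n (e : n = n) : sqcast F e = idm _.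
Proof. by rewrite (eq_irrelevance e erefl). Qed.

Lemma sqcast_comp (D : Cat) (F : nat -> D) n m k (e : n = m) (e' : m = k) :
  sqcast F e' ∘ sqcast F e = sqcast F (etrans e e').
Proof. by case: k / e'; rewrite comp1m. Qed.

Lemma sqcast_ins n m (e : n = m) k :
  (P ◁ sqcast pw e) ∘ tpow_ins P n k = tpow_ins P m k ∘ (P ◁ sqcast pw e).
Proof. by case: m / e; rewrite tensm_id comp1m compm1. Qed.

Lemma tpow_split_assoc n m k :
  massoc _ _ _ ∘ (tpow_split P n m ▷ pw k) ∘ tpow_split P (n + m) k
  = (pw n ◁ tpow_split P m k) ∘ tpow_split P n (m + k)
    ∘ sqcast pw (esym (addnA n m k)).
Proof.
elim: n => [|n IH].
  by rewrite sqcast_id compm1 /= massoc_lunit' lunit'_nat.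
rewrite (sqcast_tpowS _ (esym (addnA n m k))) /= tens_compr !compmA pentagon_l.
rewrite (compm_congl _ (massoc_nat _ _ _)) !compmA.
rewrite (compm_congl _ (massocK2 _ _ _)) compm1 !merge_l !compmA IH !tens_compl.
by rewrite !compmA massoc'_nat tensm_id.
Qed.

Lemma tpow_split_runit n : tpow_split P n 0 ∘ sqcast pw (esym (addn0 n)) = runit' _.
Proof.
elim: n => [|n IH]; first by rewrite sqcast_id compm1 /= lunit'_munit.
by rewrite (sqcast_tpowS _ (esym (addn0 n))) /= merge_l IH massoc'_runit'.
Qed.

(** Moving a factor past [m] others one at a time is a single swap with their product, by
    [transp_hexagon]; the cast is there because [(m + n).+1] and [m + n.+1] are not convertible. *)
Lemma tpow_split_move m n (e : (m + n).+1 = m + n.+1) :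
  tpow_split P m n.+1 ∘ sqcast pw e ∘ tpow_ins P (m + n) m
  = rwh (msw P (pw m)) (pw n) ∘ (P ◁ tpow_split P m n).
Proof.
elim: m e => [|m IH] e.
  rewrite sqcast_id compm1 tpow_ins0 compm1 /= rwhE -!compmA triangle'.
  by rewrite -tens_compr msw_runit' massoc_lunit'.
have e' : (m + n).+1 = m + n.+1 by case: e.
rewrite (sqcast_tpowS _ e') [tpow_ins P (m.+1 + n) _](tpow_insS (m + n)) /=.
rewrite !compmA !merge_l !compmA IH tens_compl compmA.
rewrite (compm_congl _ (esym (rwh_nat _ _))) compmA.
rewrite (compm_congl _ (esym (transp_hexagon _ _ _ _))) !compmA massocK1 comp1m.
by rewrite merge_l.
Qed.

Lemma tpow_split_msw n m :
  msw _ _ ∘ tpow_split P n m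
  = tpow_split P m n ∘ sqcast pw (addnC n m) ∘ tpow_act P (chi n m).
Proof.
elim: n => [|n IH].
  have -> : chi 0 m = 1%g.
    by apply: pval_inj => i; rewrite pval_chi /= subn0 pval1; case: ifP.
  rewrite tpow_act1 compm1 (eq_irrelevance (addnC 0 m) (esym (addn0 m))).
  rewrite tpow_split_runit /= -msw_runit' compmA.
  by rewrite msw_inv comp1m.
have V i : pval (chi n.+1 m : 'S_(n + m).+1) i
    = if i < n.+1 then i + m else if i < n.+1 + m then i - n.+1 else i.
  exact: (@pval_chi n.+1).
(* The block permutation sends 0 to [m] and acts on the remaining positions as [chi n m], which
   matches the recursion of [tpow_act]. *)
have E : perm_tail (chi n.+1 m : 'S_(n + m).+1) = chi n m.
  apply: pval_inj => i; rewrite pval_tail !V pval_chi /unbump.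
  by case_ltn; lia.
rewrite (tpow_actS (chi n.+1 m : 'S_(n + m).+1)) E V /= add0n.
have e : (m + n).+1 = m + n.+1 by rewrite addnS.
have castE : sqcast pw (addnC n.+1 m) = sqcast pw e ∘ (P ◁ sqcast pw (addnC n m)).
  rewrite -(sqcast_tpowS (congr1 S (addnC n m))).
  apply: etrans (esym (sqcast_comp _ (congr1 S (addnC n m)) e)).
  by congr sqcast; apply: eq_irrelevance.
rewrite castE -!compmA [_ ∘ (tpow_ins _ _ _ ∘ _)]compmA sqcast_ins !compmA.
rewrite tpow_split_move !merge_l !compmA -IH.
by rewrite hexagon_sw' rwhE tens_compl !compmA.
Qed.

End TensorPowers.

(** * Intertwiners and zero morphisms *)

Section Intertwine.
Variable C : SymMonCat.
Implicit Types X Y Z W A B T U : C.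

(** A naturality square in which [A] and [B] stay fixed. Such squares compose, invert and whisker,
    so those for all structure maps come from the symmetry and from left whiskering. *)
Definition intertwine X Y X' Y' A B (i : Hom X X') (j : Hom Y Y')
    (F : Hom (X ⊗ A) (Y ⊗ B)) (F' : Hom (X' ⊗ A) (Y' ⊗ B)) : Prop :=
  (j ▷ B) ∘ F = F' ∘ (i ▷ A).

Lemma intertwine_comp X Y X' Y' X'' Y'' A B (i : Hom X X') (j : Hom Y Y')
    (i' : Hom X' X'') (j' : Hom Y' Y'') (F : Hom (X ⊗ A) (Y ⊗ B))
    (F' : Hom (X' ⊗ A) (Y' ⊗ B)) (F'' : Hom (X'' ⊗ A) (Y'' ⊗ B)) :
  intertwine i j F F' -> intertwine i' j' F' F'' ->
  intertwine (i' ∘ i) (j' ∘ j) F F''.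
Proof.
rewrite /intertwine !tens_compr => E E'.
by rewrite -compmA E compmA E' compmA.
Qed.

Lemma intertwine_inv X Y X' Y' A B (i : Hom X X') (j : Hom Y Y')
    (i' : Hom X' X) (j' : Hom Y' Y) (F : Hom (X ⊗ A) (Y ⊗ B))
    (F' : Hom (X' ⊗ A) (Y' ⊗ B)) :
  i ∘ i' = idm _ -> j' ∘ j = idm _ ->
  intertwine i j F F' -> intertwine i' j' F' F.
Proof.
move=> iK jK E; apply: inverse_nat E; rewrite -tens_compr ?iK ?jK tensm_id //.
Qed.

Lemma intertwine_wl W X Y X' Y' A B (i : Hom X X') (j : Hom Y Y')
    (F : Hom (X ⊗ A) (Y ⊗ B)) (F' : Hom (X' ⊗ A) (Y' ⊗ B)) :
  intertwine i j F F' -> intertwine (W ◁ i) (W ◁ j) (wl W F) (wl W F').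
Proof. by rewrite /intertwine -!wl_tens -!wl_comp => ->. Qed.

Lemma intertwine_wl_wr W X Y A B (F : Hom (X ⊗ A) (Y ⊗ B)) :
  intertwine (msw W X) (msw W Y) (wl W F) (wr W F).
Proof.
by rewrite /intertwine wrE merge_r msw_inv tensm_id compm1.
Qed.

Lemma intertwine_wr_wl W X Y A B (F : Hom (X ⊗ A) (Y ⊗ B)) :
  intertwine (msw X W) (msw Y W) (wr W F) (wl W F).
Proof.
by apply: intertwine_inv (intertwine_wl_wr _ _); rewrite msw_inv.
Qed.

Lemma intertwine_wl_wl V W X Y A B (F : Hom (X ⊗ A) (Y ⊗ B)) :
  intertwine (massoc V W X) (massoc V W Y) (wl (V ⊗ W) F) (wl V (wl W F)).
Proof. exact: wl_wl. Qed.

Lemma intertwine_wl_wl' V W X Y A B (F : Hom (X ⊗ A) (Y ⊗ B)) :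
  intertwine (massoc' V W X) (massoc' V W Y) (wl V (wl W F)) (wl (V ⊗ W) F).
Proof.
by apply: intertwine_inv (intertwine_wl_wl _ _ _); rewrite ?massocK1 ?massocK2.
Qed.

Lemma intertwine_wl_nat W W' (w : Hom W W') X Y A B (F : Hom (X ⊗ A) (Y ⊗ B)) :
  intertwine (w ▷ X) (w ▷ Y) (wl W F) (wl W' F).
Proof. exact/esym/wl_nat. Qed.

Lemma intertwine_lunit X Y A B (F : Hom (X ⊗ A) (Y ⊗ B)) :
  intertwine (lunit X) (lunit Y) (wl munit F) F.
Proof. exact: wl_munit. Qed.

Lemma intertwine_runit X Y A B (F : Hom (X ⊗ A) (Y ⊗ B)) :
  intertwine (runit X) (runit Y) (wr munit F) F.
Proof.
rewrite -!msw_lunit.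
exact: intertwine_comp (intertwine_wr_wl _ _) (intertwine_lunit _).
Qed.

Lemma intertwine_wr_wl_assoc V W X Y A B (F : Hom (X ⊗ A) (Y ⊗ B)) :
  intertwine (massoc V X W) (massoc V Y W) (wr W (wl V F)) (wl V (wr W F)).
Proof.
(* By the hexagon, the associator brings [W] to the front, exchanges it with [V] and puts it back
   behind [U]; each of these maps has a known square. *)
have E U : massoc V U W = (V ◁ msw W U) ∘ (massoc V W U ∘ ((msw W V ▷ U)
    ∘ (massoc' W V U ∘ msw (V ⊗ U) W))).
  by rewrite !compmA -hexagon_sw -compmA msw_inv compm1.
rewrite !E.
apply: intertwine_comp _ (intertwine_wl _ (intertwine_wl_wr _ _)).
apply: intertwine_comp _ (intertwine_wl_wl _ _ _).
apply: intertwine_comp _ (intertwine_wl_nat _ _).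
exact: intertwine_comp (intertwine_wr_wl _ _) (intertwine_wl_wl' _ _ _).
Qed.

Lemma intertwine_wr_wr V W X Y A B (F : Hom (X ⊗ A) (Y ⊗ B)) :
  intertwine (massoc X V W) (massoc Y V W) (wr W (wr V F)) (wr (V ⊗ W) F).
Proof.
(* The same device with two right whiskerings: both are turned into left ones, merged into one, and
   turned back. *)
have E U : massoc U V W = msw (V ⊗ W) U ∘ ((msw W V ▷ U)
    ∘ (massoc' W V U ∘ ((W ◁ msw U V) ∘ msw (U ⊗ V) W))).
  have -> : (W ◁ msw U V) ∘ msw (U ⊗ V) W
      = massoc W V U ∘ msw U (W ⊗ V) ∘ (U ◁ msw V W) ∘ massoc U V W.
    by rewrite -msw_past' (compm_congl _ (massocK1 _ _ _)) compm1 msw_nat.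
  rewrite !compmA (compm_congl _ (massocK1 _ _ _)) compm1 msw_nat.
  rewrite (compm_congl _ (msw_inv _ _)) compm1 -tens_compl msw_inv tensm_id.
  by rewrite comp1m.
rewrite !E.
apply: intertwine_comp _ (intertwine_wl_wr _ _).
apply: intertwine_comp _ (intertwine_wl_nat _ _).
apply: intertwine_comp _ (intertwine_wl_wl' _ _ _).
exact: intertwine_comp (intertwine_wr_wl _ _) (intertwine_wl _ (intertwine_wr_wl _ _)).
Qed.

Lemma wr_comp W X Y Z A B D (F : Hom (X ⊗ A) (Y ⊗ B)) (G : Hom (Y ⊗ B) (Z ⊗ D)) :
  wr W (G ∘ F) = wr W G ∘ wr W F.
Proof. by rewrite !wrE wl_comp !compmA merge_r msw_inv tensm_id compm1. Qed.

Lemma wr_tens W X Y A B (h : Hom X Y) (k : Hom A B) :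
  wr W (h ⊠ k) = (h ▷ W) ⊠ k.
Proof.
rewrite wrE wl_tens -!tensm_comp comp1m compm1 msw_nat -compmA msw_inv.
by rewrite compm1.
Qed.

Lemma rwh_congr X Y X' Y' A B (i : Hom X X') (j : Hom Y Y')
    (F : Hom (X ⊗ A) (Y ⊗ B)) (F' : Hom (X' ⊗ A) (Y' ⊗ B)) T :
  intertwine i j F F' -> intertwine i j (rwh F T) (rwh F' T).
Proof.
by rewrite /intertwine -(tensm_id B) -(tensm_id A) -!rwh_tens -!rwh_comp => ->.
Qed.

Lemma lwh_congr X Y X' Y' A B (i : Hom X X') (j : Hom Y Y')
    (F : Hom (X ⊗ A) (Y ⊗ B)) (F' : Hom (X' ⊗ A) (Y' ⊗ B)) T :
  intertwine i j F F' -> intertwine i j (lwh T F) (lwh T F').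
Proof.
by rewrite /intertwine -(tensm_id T B) -(tensm_id T A) -!lwh_tens -!lwh_comp => ->.
Qed.

Lemma wr_star W X Y Z A B A' B' (F : Hom (X ⊗ A) (Y ⊗ B))
    (G : Hom (Y ⊗ A') (Z ⊗ B')) :
  wr W (star F G) = star (wr W F) (wr W G).
Proof.
have E : intertwine (msw W X) (msw W Z) (wl W (star F G)) (star (wr W F) (wr W G)).
  rewrite wl_star /intertwine !starE compmA.
  rewrite (lwh_congr _ (intertwine_wl_wr _ _)) -compmA.
  by rewrite (rwh_congr _ (intertwine_wl_wr _ _)) compmA.
by rewrite wrE E -compmA -tens_compr msw_inv tensm_id compm1.
Qed.

Variable O : ZeroObject C.
Hypothesis C_distr : tens_distributive C.

(** Distributivity for the empty family: the zero object is an empty coproduct, so its map to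
    [zob O ⊗ T] is invertible and [zob O ⊗ T] is initial. Hence the pairings and whiskerings are
    pointed. *)
Lemma tens_zob T (X : C) (f g : Hom (zob O ⊗ T) X) : f = g.
Proof.
have h (W : C) (a b : Hom (zob O) W) : a = b.
  by rewrite (zfrom_uniq a) (zfrom_uniq b).
have cop (A : void -> C) (a : forall i, Hom (A i) (zob O)) : is_coproduct a.
  by move=> M b; exists (zfrom O M); split=> [[]|? _]; apply: h.
have [] := C_distr (B := T) (c := zfrom O (zob O ⊗ T))
  (cop (of_void _) (fun i => match i with end))
  (cop (fun i => of_void _ i ⊗ T) (fun i => match i with end)).
  by case.
by move=> k [_ E]; apply: cancel_r E _; apply: h.
Qed.

Lemma zero_tens T (X Y : C) : zero_map O X Y ▷ T = zero_map O (X ⊗ T) (Y ⊗ T).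
Proof.
rewrite {1}/zero_map tens_compr (tens_zob (zfrom O Y ▷ T) (zero_map O _ _)).
by rewrite zero_mapr.
Qed.

Lemma tens_zero T (X Y : C) : T ◁ zero_map O X Y = zero_map O (T ⊗ X) (T ⊗ Y).
Proof.
rewrite -[LHS]compm1 -(msw_inv T X) compmA -msw_nat zero_tens zero_mapl.
by rewrite zero_mapr.
Qed.

Lemma rwh_zero X Y A B T : rwh (zero_map O (X ⊗ A) (Y ⊗ B)) T = zero_map O _ _.
Proof. by rewrite rwhE zero_tens zero_mapl zero_mapr. Qed.

Lemma lwh_zero X Y A B T : lwh T (zero_map O (X ⊗ A) (Y ⊗ B)) = zero_map O _ _.
Proof. by rewrite lwhE rwh_zero zero_mapl zero_mapr. Qed.

Lemma wl_zero X Y A B W : wl W (zero_map O (X ⊗ A) (Y ⊗ B)) = zero_map O _ _.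
Proof. by rewrite wlE tens_zero zero_mapl zero_mapr. Qed.

Lemma wr_zero X Y A B W : wr W (zero_map O (X ⊗ A) (Y ⊗ B)) = zero_map O _ _.
Proof. by rewrite wrE wl_zero zero_mapl zero_mapr. Qed.

End Intertwine.

(** * Correspondences *)

Section Corr.
Variables (C : SymMonCat) (O : ZeroObject C) (P : C) (E : RingObject C).
Implicit Types X Y Z W V : C.
Notation pw := (tpow P).

Section Powers.

(** The form uniform in [n], with source [X ⊗ munit] in degree 0, where [corr_set] has [X];
    [to_khom] and [of_khom] translate. *)
Definition khom X Y n := Hom (X ⊗ pw n) (Y ⊗ E n).

Definition kact X Y n (s : 'S_n) (F : khom X Y n) : khom X Y n :=
  (Y ◁ sqact E s) ∘ F ∘ (X ◁ tpow_act P s^-1).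

Definition kmul X Y Z n m (F : khom X Y n) (G : khom Y Z m) : khom X Z (n + m) :=
  (Z ◁ rmul E n m) ∘ star F G ∘ (X ◁ tpow_split P n m).

Definition kcast X Y n m (e : n = m) (F : khom X Y n) : khom X Y m :=
  (Y ◁ sqcast E e) ∘ F ∘ (X ◁ sqcast pw (esym e)).

Lemma kmul_act X Y Z n m (s : 'S_n) (t : 'S_m) (F : khom X Y n) (G : khom Y Z m) :
  kmul (kact s F) (kact t G) = kact (psum s t) (kmul F G).
Proof.
have -> : kact (psum s t) (kmul F G) = (Z ◁ sqact E (psum s t)) ∘ kmul F G
    ∘ (X ◁ tpow_act P (psum s^-1 t^-1)).
  congr (_ ∘ (_ ◁ tpow_act _ _)); apply: (mulgI (psum s t)).
  by rewrite mulgV psumM !mulgV psum11.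
rewrite /kmul star_nat !compmA merge_l -tpow_split_psum -!tens_compl rmul_eq.
by rewrite !tens_compl !compmA.
Qed.

(** The associators coming from [star_assoc] cancel against those of [rmulA] and [tpow_split_assoc],
    leaving the casts between the two sums. *)
Lemma kmul_assoc X Y Z W n m k (F : khom X Y n) (G : khom Y Z m) (H : khom Z W k) :
  kcast (addnA n m k) (kmul F (kmul G H)) = kmul (kmul F G) H.
Proof.
have star1 X1 Y1 Z1 A1 B1 A1' B1' A2' B2' (F1 : Hom (X1 ⊗ A1) (Y1 ⊗ B1))
    (G1 : Hom (Y1 ⊗ A1') (Z1 ⊗ B1')) (a : Hom A2' A1') (b : Hom B1' B2') :
    star F1 ((Z1 ◁ b) ∘ G1 ∘ (Y1 ◁ a)) = (Z1 ◁ (B1 ◁ b)) ∘ star F1 G1 ∘ (X1 ◁ (A1 ◁ a)).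
  by rewrite -star_nat !tensm_id comp1m compm1.
have star2 X1 Y1 Z1 A1 B1 A1' B1' A2 B2 (F1 : Hom (X1 ⊗ A1) (Y1 ⊗ B1))
    (G1 : Hom (Y1 ⊗ A1') (Z1 ⊗ B1')) (a : Hom A2 A1) (b : Hom B1 B2) :
    star ((Y1 ◁ b) ∘ F1 ∘ (X1 ◁ a)) G1 = (Z1 ◁ (b ▷ B1')) ∘ star F1 G1 ∘ (X1 ◁ (a ▷ A1')).
  by rewrite -star_nat !tensm_id comp1m compm1.
rewrite /kcast /kmul star1 star2 !compmA.
rewrite !merge_l !compmA -tpow_split_assoc -!tens_compl.
have -> : star (star F G) H
    = (W ◁ massoc' _ _ _) ∘ star F (star G H) ∘ (X ◁ massoc _ _ _).
  by rewrite -compmA -star_assoc compmA -tens_compl massocK1 tensm_id comp1m.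
rewrite !compmA !merge_l !compmA -tens_compl; congr ((_ ◁ _) ∘ _ ∘ _).
apply: cancel_r (massocK2 _ _ _) _.
rewrite (compm_congl _ (massocK1 _ _ _)) compm1 -!compmA [X in _ ∘ X]compmA.
by rewrite rmulA !compmA sqcast_comp sqcast_id comp1m.
Qed.

(** With [h] an identity this is a unit law; in general it turns squares in the enriched category
    into squares in [C]. *)
Lemma kmul_embl X Y Z n (h : Hom X Y) (G : khom Y Z n) :
  kmul (h ⊠ rone E : khom X Y 0) G = G ∘ (h ▷ pw n).
Proof.
rewrite /kmul star_unitl !compmA -tens_compl !compmA rmul1 lunitK2 tensm_id.
by rewrite comp1m -compmA -tensm_comp compm1 lunitK2.
Qed.

Lemma kmul_embr X Y Z n (F : khom X Y n) (h : Hom Y Z) :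
  kcast (addn0 n) (kmul F (h ⊠ rone E : khom Y Z 0)) = (h ▷ E n) ∘ F.
Proof.
rewrite /kcast /kmul star_unitr !compmA merge_l tpow_split_runit merge_l.
rewrite runitK2 tensm_id compm1 -!tensm_comp !comp1m !compmA.
by rewrite rmulr1 runitK2.
Qed.

Lemma wl_kmul W X Y Z n m (F : khom X Y n) (G : khom Y Z m) :
  wl W (kmul F G) = kmul (wl W F : khom _ _ n) (wl W G : khom _ _ m).
Proof. by rewrite /kmul !wl_comp !wl_tens !tensm_id wl_star. Qed.

Lemma wr_kmul W X Y Z n m (F : khom X Y n) (G : khom Y Z m) :
  wr W (kmul F G) = kmul (wr W F : khom _ _ n) (wr W G : khom _ _ m).
Proof. by rewrite /kmul !wr_comp !wr_tens !tensm_id wr_star. Qed.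

Lemma wl_kact W X Y n (s : 'S_n) (F : khom X Y n) :
  wl W (kact s F) = kact s (wl W F : khom _ _ n).
Proof. by rewrite /kact !wl_comp !wl_tens !tensm_id. Qed.

Lemma wr_kact W X Y n (s : 'S_n) (F : khom X Y n) :
  wr W (kact s F) = kact s (wr W F : khom _ _ n).
Proof. by rewrite /kact !wr_comp !wr_tens !tensm_id. Qed.

Lemma tpow_act_cast n m (e : n = m) (s : 'S_n) :
  sqcast pw e ∘ tpow_act P s = tpow_act P (cast_perm e s) ∘ sqcast pw e.
Proof. by case: m / e; rewrite cast_perm_id comp1m compm1. Qed.

Lemma kmul_interchange X X' Y Y' n m (F : khom X X' n) (G : khom Y Y' m) :
  ring_commutative E ->
  kmul (wr Y F : khom _ _ n) (wl X' G : khom _ _ m)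
  = kcast (addnC m n)
      (kact (chi m n) (kmul (wl X G : khom _ _ m) (wr Y' F : khom _ _ n))).
Proof.
move=> comm; rewrite {1}/kmul star_interchange !compmA -tens_compl comm.
rewrite merge_l tpow_split_msw /kcast /kact /kmul !tens_compl !compmA.
rewrite !merge_l; congr (_ ∘ (_ ◁ (_ ∘ _))).
rewrite tpow_act_cast (eq_irrelevance (esym _) (addnC n m)).
(* The source is acted on by the inverse of [chi m n], which is [chi n m] up to the cast. *)
congr (tpow_act _ _ ∘ _); apply: (mulIg (chi m n)); rewrite mulVg.
by apply: pval_inj => i; rewrite !pvalE; case_ltn; lia.
Qed.

End Powers.

(** * Transfer to correspondences as defined, with the exceptional degree 0 *)

Section XPowers.
Variables X Y : C.

Lemma xpowK n : xpow_out P X n ∘ xpow_in P X n = idm _.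
Proof. by case: n => [|n] /=; rewrite ?runitK2 ?comp1m. Qed.

Lemma xpowK' n : xpow_in P X n ∘ xpow_out P X n = idm _.
Proof. by case: n => [|n] /=; rewrite ?runitK1 ?comp1m. Qed.

Definition to_khom n (f : corr_set O P E X Y n) : khom X Y n := f ∘ xpow_out P X n.

Definition of_khom n (F : khom X Y n) : corr_set O P E X Y n := F ∘ xpow_in P X n.

Lemma of_khomK n (F : khom X Y n) : to_khom (of_khom F) = F.
Proof. by rewrite /to_khom /of_khom -compmA xpowK' compm1. Qed.

Lemma to_khomK n (f : corr_set O P E X Y n) : of_khom (to_khom f) = f.
Proof. by rewrite /to_khom /of_khom -compmA xpowK compm1. Qed.

Lemma to_khom_inj n : injective (@to_khom n).
Proof. exact: can_inj (@to_khomK n). Qed.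

Lemma to_khom_pt n : to_khom (pt : corr_set O P E X Y n) = zero_map O _ _.
Proof. exact: zero_mapr. Qed.

Lemma to_khom_act n (s : 'S_n) (f : corr_set O P E X Y n) :
  to_khom (corr_act s f) = kact s (to_khom f).
Proof.
by rewrite /to_khom /corr_act /kact !compmA (compm_congl _ (xpowK' _)) compm1.
Qed.

Lemma corr_laws : is_symseq (corr_data O P E X Y).
Proof.
split=> [n|n s t]; apply: pmap_eq => f; apply: to_khom_inj; rewrite !to_khom_act /kact.
  by rewrite (sqlaws E).1 invg1 tpow_act1 !tensm_id comp1m compm1.
by rewrite (sqlaws E).2 invMg tpow_actM !tens_compl !compmA.
Qed.

Definition chom : SymPSet := MkSymSeq corr_laws.

Lemma to_khom_scast n m (e : n = m) (f : el chom n) :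
  to_khom (scast e f : el chom m) = kcast e (to_khom f).
Proof.
by case: m / e; rewrite scast_id /kcast /= !tensm_id comp1m compm1.
Qed.

Lemma to_khom_sact n (s : 'S_n) (f : el chom n) : to_khom (sact s f) = kact s (to_khom f).
Proof. exact: to_khom_act. Qed.

End XPowers.

Definition cmul X Y Z n m (f : el (chom X Y) n) (g : el (chom Y Z) m) :
    el (chom X Z) (n + m) := corr_mul (O := O) f g.

Lemma to_khom_cmul X Y Z n m (f : el (chom X Y) n) (g : el (chom Y Z) m) :
  to_khom (cmul f g) = kmul (to_khom f) (to_khom g).
Proof.
rewrite /to_khom /cmul /corr_mul /kmul (compm_congl _ (xpowK' _ _)) compm1.
by rewrite starE lwhE !rwhE !compmA -!tens_compl.
Qed.

Definition cemb X Y (h : Hom X Y) : el (chom X Y) 0 := (h ⊠ rone E) ∘ runit' X.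

Lemma to_khom_emb X Y (h : Hom X Y) : to_khom (cemb h) = h ⊠ rone E.
Proof. by rewrite /to_khom /cemb -compmA /= runitK1 compm1. Qed.

Lemma corr_mul_act X Y Z n m (s : 'S_n) (t : 'S_m) (f : el (chom X Y) n)
    (g : el (chom Y Z) m) :
  cmul (sact s f) (sact t g)
  = sact (psum s t) (cmul f g : el (chom X Z) (n + m)).
Proof. by apply: to_khom_inj; rewrite to_khom_sact !to_khom_cmul !to_khom_sact kmul_act. Qed.

Lemma corr_mulA X Y Z W n m k (f : el (chom X Y) n) (g : el (chom Y Z) m)
    (h : el (chom Z W) k) :
  scast (addnA n m k) (cmul f (cmul g h) : el (chom X W) _)
  = cmul (cmul f g) h.
Proof. by apply: to_khom_inj; rewrite to_khom_scast !to_khom_cmul kmul_assoc. Qed.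

Lemma corr_mul1 X Y n (f : el (chom X Y) n) : cmul (cemb (idm X)) f = f.
Proof. by apply: to_khom_inj; rewrite to_khom_cmul to_khom_emb kmul_embl tensm_id compm1. Qed.

Lemma corr_mulr1 X Y n (f : el (chom X Y) n) :
  scast (addn0 n) (cmul f (cemb (idm Y)) : el (chom X Y) _) = f.
Proof.
by apply: to_khom_inj; rewrite to_khom_scast to_khom_cmul to_khom_emb kmul_embr tensm_id comp1m.
Qed.

Lemma corr_mul_emb X Y Z (h : Hom X Y) (k : Hom Y Z) :
  cmul (cemb h) (cemb k) = cemb (k ∘ h) :> el (chom X Z) 0.
Proof.
apply: to_khom_inj; rewrite [LHS](to_khom_cmul (cemb h) (cemb k)) !to_khom_emb kmul_embl.
rewrite -tensm_comp.
by rewrite compm1.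
Qed.

Section Pointed.
Hypothesis C_distr : tens_distributive C.

Lemma corr_mul_ptl X Y Z n m (g : el (chom Y Z) m) :
  cmul (ept : el (chom X Y) n) g = (ept : el (chom X Z) (n + m)).
Proof.
apply: to_khom_inj; rewrite to_khom_cmul !to_khom_pt /kmul starE rwh_zero //.
by rewrite !(zero_mapl, zero_mapr).
Qed.

Lemma corr_mul_ptr X Y Z n m (f : el (chom X Y) n) :
  cmul f (ept : el (chom Y Z) m) = (ept : el (chom X Z) (n + m)).
Proof.
apply: to_khom_inj; rewrite to_khom_cmul !to_khom_pt /kmul starE lwh_zero //.
by rewrite !(zero_mapl, zero_mapr).
Qed.

Definition cwl_fun W X Y n (f : el (chom X Y) n) : el (chom (W ⊗ X) (W ⊗ Y)) n :=
  of_khom (wl W (to_khom f) : khom _ _ n).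

Definition cwr_fun W X Y n (f : el (chom X Y) n) : el (chom (X ⊗ W) (Y ⊗ W)) n :=
  of_khom (wr W (to_khom f) : khom _ _ n).

Program Definition cwl W X Y : sqhom (chom X Y) (chom (W ⊗ X) (W ⊗ Y)) :=
  mk_sqhom (f := @cwl_fun W X Y) _ _.
Next Obligation.
by move=> W X Y n; apply: to_khom_inj; rewrite of_khomK !to_khom_pt wl_zero.
Qed.
Next Obligation.
by move=> W X Y n s f; apply: to_khom_inj; rewrite to_khom_sact !of_khomK !to_khom_sact wl_kact.
Qed.

Program Definition cwr W X Y : sqhom (chom X Y) (chom (X ⊗ W) (Y ⊗ W)) :=
  mk_sqhom (f := @cwr_fun W X Y) _ _.
Next Obligation.
by move=> W X Y n; apply: to_khom_inj; rewrite of_khomK !to_khom_pt wr_zero.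
Qed.
Next Obligation.
by move=> W X Y n s f; apply: to_khom_inj; rewrite to_khom_sact !of_khomK !to_khom_sact wr_kact.
Qed.

Lemma to_khom_cwl W X Y n (f : el (chom X Y) n) : to_khom (ap (cwl W X Y) f) = wl W (to_khom f).
Proof. exact: of_khomK. Qed.

Lemma to_khom_cwr W X Y n (f : el (chom X Y) n) : to_khom (ap (cwr W X Y) f) = wr W (to_khom f).
Proof. exact: of_khomK. Qed.

Program Definition ccomp X Y Z : sqhom (day (chom X Y) (chom Y Z)) (chom X Z) :=
  day_elim (fun n m (f : el (chom X Y) n) (g : el (chom Y Z) m) =>
    cmul f g : el (chom X Z) (n + m)) _ _ _.
Next Obligation. by move=> *; apply: corr_mul_ptl. Qed.
Next Obligation. by move=> *; apply: corr_mul_ptr. Qed.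
Next Obligation. by move=> *; apply: corr_mul_act. Qed.

End Pointed.

End Corr.

(** * The enriched category *)

(** Every element is a translate of one with trivial labels, and morphisms are equivariant. *)
Lemma day_ext3 (X Y Z W : SymPSet) (f g : sqhom (day (day X Y) Z) W) :
  (forall p q r (x : el X p) (y : el Y q) (z : el Z r),
     ap f (dmk erefl 1 (dmk erefl 1 x y) z) = ap g (dmk erefl 1 (dmk erefl 1 x y) z)) ->
  f = g.
Proof.
move=> H; apply: day_ext => m r u z.
have [p [q [e [a [x [y ->]]]]]] := day_elP u; subst m.
by rewrite -[a]mul1g -dmk_act -[z]sact1 dmk_act1 !ap_act H.
Qed.

Lemma day_ext4 (X Y Z W V : SymPSet) (f g : sqhom (day (day X Y) (day Z W)) V) :
  (forall p q r s (x : el X p) (y : el Y q) (z : el Z r) (w : el W s),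
     ap f (dmk erefl 1 (dmk erefl 1 x y) (dmk erefl 1 z w))
     = ap g (dmk erefl 1 (dmk erefl 1 x y) (dmk erefl 1 z w))) ->
  f = g.
Proof.
move=> H; apply: day_ext3 => p q n x y v.
have [r [s [e [a [z [w ->]]]]]] := day_elP v; subst n.
rewrite -[a]mul1g -dmk_act -[dmk erefl 1 x y]sact1 dmk_act1 !ap_act.
by rewrite H.
Qed.

Section Point.
Variable X : SymPSet.

(** Morphisms from the unit amount to elements of degree 0, since [dunit] is a single point in
    positive degrees. *)
Definition dpoint_fun (x : el X 0) n : el dunit n -> el X n :=
  match n return el dunit n -> el X n with
  | 0 => fun b => if (b : bool) then x else ept
  | _.+1 => fun _ => ept
  end.

Program Definition dpoint (x : el X 0) : sqhom dunit X :=
  mk_sqhom (f := dpoint_fun x) _ _.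
Next Obligation. by move=> x []. Qed.
Next Obligation.
by move=> x [|n] s b; [rewrite (perm_S0 s) !sact1|rewrite /= sact_pt].
Qed.

Lemma ap_dpoint (x : el X 0) : ap (dpoint x) dunit1 = x.
Proof. by []. Qed.

Lemma dunit_ext (f g : sqhom dunit X) : ap f dunit1 = ap g dunit1 -> f = g.
Proof.
move=> H; apply: sqhom_ext => -[|n] []; first exact: H.
  by rewrite -[false]/(ept : el dunit 0) !ap_pt.
by rewrite -[tt]/(ept : el dunit n.+1) !ap_pt.
Qed.

End Point.

(** Of the four blocks only the middle two change places, whence [chi r q] between two
    identities. *)
Lemma interchangeE (X Y Z W : SymPSet) p q r s (x : el X p) (y : el Y q)
    (z : el Z r) (w : el W s) (e : p + r + (q + s) = p + q + (r + s))
    (e' : p + (r + q + s) = p + q + (r + s)) :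
  ap (interchange (V := SymPSetMon) X Y Z W)
    (dmk erefl 1 (dmk erefl 1 x y) (dmk erefl 1 z w))
  = dmk e (cast_perm e' (psum 1 (psum (chi r q) 1)))
      (dmk erefl 1 x z) (dmk erefl 1 y w).
Proof.
have -> : interchange (V := SymPSetMon) X Y Z W = sqcomp
    (sqcomp (dassoc' X Z (day Y W))
       (dmap (sqid X) (sqcomp (sqcomp (dassoc Z Y W) (dmap (dsw Y Z) (sqid W)))
          (dassoc' Y Z W))))
    (dassoc X Y (day Z W)) by [].
have e1 : p + (q + (r + s)) = p + q + (r + s) by lia.
have e2 : q + r + s = q + (r + s) by lia.
rewrite !ap_comp (dassocE _ _ e1) dmapE ap_id !ap_comp.
rewrite (dassoc'E _ _ e2) dmapE (dswE _ (addnC r q)) ap_id.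
have e3 : r + (q + s) = q + (r + s) by lia.
rewrite (dassocE _ _ e3) (dassoc'E _ _ e).
apply: dmk_eq => i; rewrite !psum11 !pvalE.
by case_ltn; lia.
Qed.

Section Enriched.
Variables (C : SymMonCat) (O : ZeroObject C) (C_distr : tens_distributive C).
Variables (P : C) (E : RingObject C).
Implicit Types X Y Z W V : C.
Notation hom := (chom O P E).
Notation comp := (ccomp O P E C_distr).
Notation WL W X Y := (cwl O P E C_distr W X Y).
Notation WR W X Y := (cwr O P E C_distr W X Y).

(** Keeping [e] and [a] as arguments lets associativity be applied to nested composites in any
    degree, with no casts between them; labels are compared at the end by [cc_eq]. *)
Definition cc X Y Z n p q (e : p + q = n) (a : 'S_n) (f : el (hom X Y) p)
    (g : el (hom Y Z) q) : el (hom X Z) n := ap (comp X Y Z) (dmk e a f g).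

Lemma ccE X Y Z n p q (e : p + q = n) (a : 'S_n) (f : el (hom X Y) p)
    (g : el (hom Y Z) q) : cc e a f g = sact a (scast e (cmul f g)).
Proof. by rewrite /cc day_elimE. Qed.

Lemma cc_eq X Y Z n p q (e e' : p + q = n) (a a' : 'S_n) (f : el (hom X Y) p)
    (g : el (hom Y Z) q) : pval a =1 pval a' -> cc e a f g = cc e' a' f g.
Proof. by move=> H; congr ap; apply: dmk_eq. Qed.

Lemma cc_nestl X Y Z W n m p q r (e : m + r = n) (e' : p + q = m)
    (e'' : p + q + r = n) a b (f : el (hom X Y) p) (g : el (hom Y Z) q)
    (h : el (hom Z W) r) :
  cc e a (cc e' b f g) h
  = cc e'' (cast_perm e (psum b 1) * a) (cc erefl 1 f g) h.
Proof.
have L := dmapE (comp X Y Z) (sqid (hom Z W)).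
by rewrite /cc -{1}[h]ap_id -L (dmk_nestl _ _ e'') L.
Qed.

Lemma cc_nestr X Y Z W n m p q r (e : p + m = n) (e' : q + r = m)
    (e'' : p + (q + r) = n) a b (f : el (hom X Y) p) (g : el (hom Y Z) q)
    (h : el (hom Z W) r) :
  cc e a f (cc e' b g h)
  = cc e'' (cast_perm e (psum 1 b) * a) f (cc erefl 1 g h).
Proof.
have L := dmapE (sqid (hom X Y)) (comp Y Z W).
by rewrite /cc -{1}[f]ap_id -L (dmk_nestr _ _ e'') L.
Qed.

Lemma compA X Y Z W :
  sqcomp (comp X Z W) (dmap (comp X Y Z) (sqid (hom Z W)))
  = sqcomp (sqcomp (comp X Y W) (dmap (sqid (hom X Y)) (comp Y Z W)))
      (dassoc (hom X Y) (hom Y Z) (hom Z W)).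
Proof.
apply: day_ext3 => n m k f g h; rewrite !ap_comp dmapE ap_id.
rewrite (dassocE _ _ (addnA n m k)) dmapE ap_id !day_elimE !sact1 !scast_id.
by rewrite !psum11 /= -corr_mulA mulg1 sact1.
Qed.

Lemma ccA X Y Z W n m p q r (e : m + r = n) (e' : p + q = m)
    (e'' : p + (q + r) = n) a b (f : el (hom X Y) p) (g : el (hom Y Z) q)
    (h : el (hom Z W) r) :
  cc e a (cc e' b f g) h
  = cc e'' (cast_perm e (psum b 1) * a) f (cc erefl 1 g h).
Proof.
have := congr1 (fun F => ap F (dmk e a (dmk e' b f g) h)) (compA X Y Z W).
by rewrite !ap_comp dmapE (dassocE _ _ e'') dmapE !ap_id.
Qed.

Lemma ccA' X Y Z W n m p q r (e : p + m = n) (e' : q + r = m)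
    (e'' : p + q + r = n) a b (f : el (hom X Y) p) (g : el (hom Y Z) q)
    (h : el (hom Z W) r) :
  cc e a f (cc e' b g h)
  = cc e'' (cast_perm e (psum 1 b) * a) (cc erefl 1 f g) h.
Proof.
have e3 : p + (q + r) = n by rewrite e' e.
rewrite (cc_nestr _ _ e3) (ccA _ _ e3); apply: cc_eq => i.
by rewrite !psum11 !pvalE.
Qed.

Notation emb := (cemb O P E).

Lemma comp_unitl X Y :
  sqcomp (comp X X Y) (dmap (dpoint (emb (idm X))) (sqid (hom X Y)))
  = dlunit (hom X Y).
Proof.
apply: day_ext => -[|n] m [] f; rewrite ap_comp dmapE ap_id; last first.
- by rewrite (dmk_ptl _ _ _ (p := n.+1)) [in RHS](dmk_ptl _ _ _ (p := n.+1)) !ap_pt.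
- by rewrite -[false]/(ept : el dunit 0) ap_pt !dmk_ptl !ap_pt.
by rewrite [RHS]dlunitE -[LHS]/(cc _ _ _ _) ccE scast_id ap_dpoint corr_mul1.
Qed.

Lemma comp_unitr X Y :
  sqcomp (comp X Y Y) (dmap (sqid (hom X Y)) (dpoint (emb (idm Y))))
  = drunit (hom X Y).
Proof.
apply: day_ext => n [|m] f []; rewrite ap_comp dmapE ap_id; last first.
- by rewrite (dmk_ptr _ _ _ (q := m.+1)) [in RHS](dmk_ptr _ _ _ (q := m.+1)) !ap_pt.
- by rewrite -[false]/(ept : el dunit 0) ap_pt !dmk_ptr !ap_pt.
rewrite -[LHS]/(cc _ _ _ _) ccE sact1 ap_dpoint day_elimE !sact1 !scast_id /=.
by rewrite -[f in RHS]corr_mulr1 scast_comp scast_id.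
Qed.

Lemma cwl_cc W X Y Z n p q (e : p + q = n) (a : 'S_n) (f : el (hom X Y) p)
    (g : el (hom Y Z) q) :
  ap (WL W X Z) (cc e a f g) = cc e a (ap (WL W X Y) f) (ap (WL W Y Z) g).
Proof.
rewrite !ccE ap_act ap_cast; congr (sact _ (scast _ _)).
by apply: to_khom_inj; rewrite to_khom_cwl !to_khom_cmul !to_khom_cwl wl_kmul.
Qed.

Lemma cwr_cc W X Y Z n p q (e : p + q = n) (a : 'S_n) (f : el (hom X Y) p)
    (g : el (hom Y Z) q) :
  ap (WR W X Z) (cc e a f g) = cc e a (ap (WR W X Y) f) (ap (WR W Y Z) g).
Proof.
rewrite !ccE ap_act ap_cast; congr (sact _ (scast _ _)).
by apply: to_khom_inj; rewrite to_khom_cwr !to_khom_cmul !to_khom_cwr wr_kmul.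
Qed.

Lemma cwl_emb W X Y (h : Hom X Y) : ap (WL W X Y) (emb h) = emb (W ◁ h).
Proof. by apply: to_khom_inj; rewrite to_khom_cwl !to_khom_emb wl_tens. Qed.

Lemma cwr_emb W X Y (h : Hom X Y) : ap (WR W X Y) (emb h) = emb (h ▷ W).
Proof. by apply: to_khom_inj; rewrite to_khom_cwr !to_khom_emb wr_tens. Qed.

Lemma cc_emb X Y Z (e : 0 + 0 = 0) (h : Hom X Y) (k : Hom Y Z) :
  cc e 1 (emb h) (emb k) = emb (k ∘ h).
Proof. by rewrite ccE sact1 scast_id corr_mul_emb. Qed.

Lemma cc_intertwine X Y X' Y' n (i : Hom X X') (j : Hom Y Y')
    (f : el (hom X Y) n) (f' : el (hom X' Y') n) :
  intertwine i j (to_khom (O := O) f) (to_khom (O := O) f') ->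
  cc (addn0 n) 1 f (emb j) = cc (add0n n) 1 (emb i) f'.
Proof.
move=> H; rewrite !ccE !sact1 scast_id; apply: to_khom_inj.
rewrite to_khom_scast [RHS](to_khom_cmul (emb i) f') to_khom_cmul !to_khom_emb.
by rewrite [RHS]kmul_embl kmul_embr H.
Qed.

Lemma cc_interchange X X' Y Y' n p q (e : p + q = n) (e' : q + p = n) a
    (f : el (hom X X') p) (g : el (hom Y Y') q) :
  ring_commutative E ->
  cc e a (ap (WR Y X X') f) (ap (WL X' Y Y') g)
  = cc e' (cast_perm e' (chi q p) * a) (ap (WL X Y Y') g) (ap (WR Y' X X') f).
Proof.
move=> comm; rewrite !ccE sactM -scast_act; congr sact.
have -> : cmul (ap (WR Y X X') f) (ap (WL X' Y Y') g)
    = scast (addnC q p) (sact (chi q p)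
        (cmul (ap (WL X Y Y') g) (ap (WR Y' X X') f))).
  apply: to_khom_inj; rewrite to_khom_scast to_khom_sact !to_khom_cmul !to_khom_cwl !to_khom_cwr.
  exact: kmul_interchange.
by rewrite scast_comp (eq_irrelevance (etrans _ _) e').
Qed.

(** * The product of correspondences and its compatibility with composition *)

Definition cprod X X' Y Y' : sqhom (day (hom X X') (hom Y Y'))
    (hom (X ⊗ Y) (X' ⊗ Y')) :=
  sqcomp (comp _ _ _) (dmap (WR Y X X') (WL X' Y Y')).

Lemma cprodE X X' Y Y' n p q (e : p + q = n) a (f : el (hom X X') p)
    (g : el (hom Y Y') q) :
  ap (cprod X X' Y Y') (dmk e a f g)
  = cc e a (ap (WR Y X X') f) (ap (WL X' Y Y') g).
Proof. by rewrite ap_comp dmapE. Qed.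

(** As whiskering preserves composition, both sides compose the same four whiskered morphisms up to
    the order of [f'] and [g]. [cc_interchange] exchanges these two, and its block permutation
    cancels the one produced by [interchange]. *)
Lemma cprod_comp X X' X'' Y Y' Y'' : ring_commutative E ->
  sqcomp (cprod X X'' Y Y'') (sqcomp (dmap (comp X X' X'') (comp Y Y' Y''))
    (interchange (V := SymPSetMon) (hom X X') (hom Y Y') (hom X' X'') (hom Y' Y'')))
  = sqcomp (comp _ _ _) (dmap (cprod X X' Y Y') (cprod X' X'' Y' Y'')).
Proof.
move=> comm; apply: day_ext4 => p q r s f g f' g'.
rewrite [LHS](ap_comp (cprod _ _ _ _)) [X in ap (cprod _ _ _ _) X](ap_comp (dmap _ _)).
have e0 : p + (r + q + s) = p + q + (r + s) by lia.
have e1 : p + r + (q + s) = p + q + (r + s) by lia.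
rewrite (interchangeE _ _ _ _ e1 e0) dmapE cprodE -2!/(cc _ _ _ _) cwr_cc cwl_cc.
rewrite [RHS](ap_comp (comp _ _ _)) dmapE !cprodE -[RHS]/(cc _ _ _ _).
have e2 : p + (r + (q + s)) = p + q + (r + s) by lia.
have e3 : p + (q + (r + s)) = p + q + (r + s) by lia.
have e4 : r + q + s = r + (q + s) by lia.
have e5 : q + r + s = q + (r + s) by lia.
have e6 : q + r + s = r + (q + s) by lia.
have e7 : p + (q + r + s) = p + q + (r + s) by lia.
rewrite (ccA _ _ e2) (ccA' _ _ e4) (cc_interchange _ (addnC q r)) // (cc_nestl _ _ e6).
rewrite (cc_nestr _ _ e7) [RHS](ccA _ _ e3) (ccA' _ _ e5) [RHS](cc_nestr _ _ e7).
apply: cc_eq => i; rewrite !psum11 !pvalE.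
by case_ltn; lia.
Qed.

(* The square [f; j = i; f'] in the enriched category. *)
Definition csquare X Y X' Y' (i : Hom X X') (j : Hom Y Y') n
    (f : el (hom X Y) n) (f' : el (hom X' Y') n) : Prop :=
  cc (addn0 n) 1 f (emb j) = cc (add0n n) 1 (emb i) f'.

Lemma csquare_cc X Y Z X' Y' Z' n p q (e : p + q = n) a (i : Hom X X')
    (j : Hom Y Y') (k : Hom Z Z') (f : el (hom X Y) p) (f' : el (hom X' Y') p)
    (g : el (hom Y Z) q) (g' : el (hom Y' Z') q) :
  csquare i j f f' -> csquare j k g g' ->
  csquare i k (cc e a f g) (cc e a f' g').
Proof.
rewrite /csquare => H K.
have e1 : p + (q + 0) = n by rewrite addn0.
have e2 : p + (0 + q) = n by [].
have e3 : 0 + p + q = n by [].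
(* Pasting: [f; g; k] becomes [f; j; g'] by the second square, then [i; f'; g'] by the first. *)
transitivity (cc e a f (cc (addn0 q) 1 g (emb k))).
  rewrite [LHS](ccA _ _ e1) [RHS](cc_nestr _ _ e1); apply: cc_eq => i0; rewrite !pvalE.
  have -> : (if i0 < p then i0 else p + (i0 - p)) = i0 by case_ltn; lia.
  by case: ltnP => // h; rewrite pval_out // subnKC.
transitivity (cc e a (cc (addn0 p) 1 f (emb j)) g').
  rewrite K [LHS](cc_nestr _ _ e2) [RHS](ccA _ _ e2); apply: cc_eq => i0.
  by rewrite !psum11 !pvalE.
rewrite H [LHS](cc_nestl _ _ e3) [RHS](ccA' _ _ e3); apply: cc_eq => i0; rewrite !pvalE.
rewrite /= add0n subn0; congr (pval a _).
by case_ltn; lia.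
Qed.

(** The shape of [is_vnat] at one pair of objects when the components are embedded morphisms of
    [C]. *)
Definition nat_square (S : SymPSet) X Y X' Y' (i : Hom X X') (j : Hom Y Y')
    (F : sqhom S (hom X Y)) (G : sqhom S (hom X' Y')) : Prop :=
  sqcomp (sqcomp (comp X Y Y') (dmap F (dpoint (emb j)))) (drunit' S)
  = sqcomp (sqcomp (comp X X' Y') (dmap (dpoint (emb i)) G)) (dlunit' S).

Lemma csquare_intertwine X Y X' Y' (i : Hom X X') (j : Hom Y Y') n
    (f : el (hom X Y) n) (f' : el (hom X' Y') n) :
  intertwine i j (to_khom (O := O) f) (to_khom (O := O) f') -> csquare i j f f'.
Proof. exact: cc_intertwine. Qed.

Lemma csquare_eq (S : SymPSet) X Y X' Y' (i : Hom X X') (j : Hom Y Y')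
    (F : sqhom S (hom X Y)) (G : sqhom S (hom X' Y')) n (u : el S n) :
  csquare i j (ap F u) (ap G u) ->
  ap (sqcomp (sqcomp (comp X Y Y') (dmap F (dpoint (emb j)))) (drunit' S)) u
  = ap (sqcomp (sqcomp (comp X X' Y') (dmap (dpoint (emb i)) G)) (dlunit' S)) u.
Proof.
move=> H; rewrite [LHS](ap_comp (sqcomp _ _)) [RHS](ap_comp (sqcomp _ _)).
rewrite [LHS](ap_comp (comp _ _ _)) [RHS](ap_comp (comp _ _ _)) !dmapE.
exact: H.
Qed.

Lemma cprod_massoc X X' Y Y' Z Z' :
  nat_square (massoc X Y Z) (massoc X' Y' Z')
    (sqcomp (cprod (X ⊗ Y) (X' ⊗ Y') Z Z') (dmap (cprod X X' Y Y') (sqid _)))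
    (sqcomp (cprod X X' (Y ⊗ Z) (Y' ⊗ Z'))
       (sqcomp (dmap (sqid _) (cprod Y Y' Z Z')) (dassoc _ _ _))).
Proof.
apply: day_ext3 => p q r f g h; apply: csquare_eq.
rewrite (ap_comp (cprod (X ⊗ Y) _ _ _)) dmapE ap_id cprodE.
rewrite (ap_comp (cprod X _ _ _)) (ap_comp (dmap _ _)) (dassocE _ _ (addnA p q r)).
rewrite dmapE ap_id !cprodE cwr_cc cwl_cc (ccA' _ _ (erefl (p + q + r))).
rewrite !psum11 /= !mulg1.
have -> : cast_perm (addnA p q r) 1 = 1%g by apply: pval_inj => i; rewrite !pvalE.
(* One square for each of [f], [g], [h]: whiskered twice on the right, once on each side, and twice
   on the left. *)
apply: csquare_cc; first apply: csquare_cc.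
- apply: csquare_intertwine; rewrite !to_khom_cwr; exact: intertwine_wr_wr.
- by apply: csquare_intertwine; rewrite to_khom_cwr !to_khom_cwl to_khom_cwr; exact: intertwine_wr_wl_assoc.
- apply: csquare_intertwine; rewrite !to_khom_cwl; exact: intertwine_wl_wl.
Qed.

Lemma cprod_lunit X X' :
  nat_square (lunit X) (lunit X')
    (sqcomp (cprod munit munit X X')
       (sqcomp (dmap (dpoint (emb (idm munit))) (sqid _)) (dlunit' _)))
    (sqid (hom X X')).
Proof.
apply: sqhom_ext => n f; apply: csquare_eq.
rewrite (ap_comp (cprod _ _ _ _)) (ap_comp (dmap _ _)) dmapE ap_id cprodE ap_dpoint.
rewrite cwr_emb tensm_id ccE sact1 scast_id corr_mul1.
by apply: csquare_intertwine; rewrite to_khom_cwl; exact: intertwine_lunit.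
Qed.

Lemma cprod_runit X X' :
  nat_square (runit X) (runit X')
    (sqcomp (cprod X X' munit munit)
       (sqcomp (dmap (sqid _) (dpoint (emb (idm munit)))) (drunit' _)))
    (sqid (hom X X')).
Proof.
apply: sqhom_ext => n f; apply: csquare_eq.
rewrite (ap_comp (cprod _ _ _ _)) (ap_comp (dmap _ _)) dmapE ap_id cprodE ap_dpoint.
rewrite cwl_emb tensm_id ccE sact1 corr_mulr1.
by apply: csquare_intertwine; rewrite to_khom_cwr; exact: intertwine_runit.
Qed.

Lemma cprod_msw X X' Y Y' : ring_commutative E ->
  nat_square (msw X Y) (msw X' Y') (cprod X X' Y Y')
    (sqcomp (cprod Y Y' X X') (dsw (hom X X') (hom Y Y'))).
Proof.
move=> comm; apply: day_ext => p q f g; apply: csquare_eq.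
rewrite (ap_comp (cprod _ _ _ _)) (dswE _ (addnC q p)) !cprodE.
rewrite (cc_interchange _ (erefl (p + q))) //.
(* The block permutation of [dsw] cancels the one that [cc_interchange] introduces. *)
set c := (a in cc _ a (ap (WL Y X X') f) _).
have -> : c = 1%g by apply: pval_inj => i; rewrite !pvalE; case_ltn; lia.
apply: csquare_cc; apply: csquare_intertwine; rewrite to_khom_cwl to_khom_cwr.
  exact: intertwine_wr_wl.
exact: intertwine_wl_wr.
Qed.

Lemma ucomp_emb X Y Z (h : Hom X Y) (k : Hom Y Z) :
  sqcomp (sqcomp (comp X Y Z) (dmap (dpoint (emb h)) (dpoint (emb k)))) (dlunit' dunit)
  = dpoint (emb (k ∘ h)).
Proof.
apply: dunit_ext; rewrite ap_dpoint -(cc_emb (addn0 0)).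
by rewrite (ap_comp (sqcomp _ _)) (ap_comp (comp _ _ _)) dmapE; apply: cc_eq.
Qed.

Lemma uprod_emb X X' Y Y' (h : Hom X X') (k : Hom Y Y') :
  sqcomp (sqcomp (cprod X X' Y Y') (dmap (dpoint (emb h)) (dpoint (emb k))))
    (dlunit' dunit)
  = dpoint (emb (h ⊠ k)).
Proof.
apply: dunit_ext; rewrite ap_dpoint -tens_rl -(cc_emb (addn0 0)) -cwr_emb -cwl_emb.
rewrite (ap_comp (sqcomp _ _)) (ap_comp (cprod _ _ _ _)) dmapE cprodE.
exact: cc_eq.
Qed.

Lemma cprod_unit X Y :
  sqcomp (cprod X X Y Y)
    (sqcomp (dmap (dpoint (emb (idm X))) (dpoint (emb (idm Y)))) (dlunit' dunit))
  = dpoint (emb (idm (X ⊗ Y))).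
Proof. by rewrite -tensm_id -uprod_emb; apply: sqhom_ext. Qed.

(** * The enriched category on [B] and its symmetric monoidal structure *)

Variable B : C -> Prop.
Hypothesis B_prod : forall X Y : C, B X -> B Y -> B (X ⊗ Y).

Definition corr_cat : VCatData SymPSetMon :=
  corr_vcat (hact := fun X Y : full_ob B => corr_laws O P E (sval X) (sval Y))
    (fun X Y Z : full_ob B => comp (sval X) (sval Y) (sval Z))
    (fun X : full_ob B => dpoint (emb (idm (sval X)))).

Lemma corr_cat_is_vcat : is_vcat corr_cat.
Proof.
split=> [X Y Z W|X Y|X Y]; [exact: compA|exact: comp_unitl|exact: comp_unitr].
Qed.

Lemma corr_cat_iso (X Y : corr_cat) (i : Hom (sval X) (sval Y))
    (i' : Hom (sval Y) (sval X)) : are_inverse i i' ->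
  u_inverse (dpoint (emb i) : uhom X Y) (dpoint (emb i') : uhom Y X).
Proof.
case=> iK jK; split; apply: etrans (ucomp_emb _ _) _.
  by rewrite iK.
by rewrite jK.
Qed.

Lemma vidE (X : corr_cat) : vid X = dpoint (emb (idm (sval X))).
Proof. by []. Qed.

Lemma ucompE (X Y Z : corr_cat) (h : Hom (sval X) (sval Y))
    (k : Hom (sval Y) (sval Z)) :
  ucomp (dpoint (emb h) : uhom X Y) (dpoint (emb k) : uhom Y Z)
  = (dpoint (emb (k ∘ h)) : uhom X Z).
Proof. exact: ucomp_emb. Qed.

Lemma uprodE (X X' Y Y' : corr_cat) (h : Hom (sval X) (sval X'))
    (k : Hom (sval Y) (sval Y')) :
  uprod (A := corr_cat) (prod := sub_prod B_prod)
    (fun X X' Y Y' : full_ob B => cprod (sval X) (sval X') (sval Y) (sval Y'))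
    (dpoint (emb h) : uhom X X') (dpoint (emb k) : uhom Y Y')
  = (dpoint (emb (h ⊠ k)) : uhom (A := corr_cat) (sub_prod B_prod X Y) (sub_prod B_prod X' Y')).
Proof. exact: uprod_emb. Qed.

Section SymMon.
Hypothesis comm : ring_commutative E.
Hypothesis B_unit : B munit.

Lemma corr_cat_symmon :
  inhabited (SymMonVCat (A := corr_cat) (sub_prod B_prod) (exist B munit B_unit)).
Proof.
constructor; apply: (@MkSymMonVCat SymPSetMon corr_cat (sub_prod B_prod) (exist B munit B_unit)
  (fun X X' Y Y' : full_ob B => cprod (sval X) (sval X') (sval Y) (sval Y'))
  (fun X Y Z : full_ob B => dpoint (emb (massoc (sval X) (sval Y) (sval Z))))
  (fun X : full_ob B => dpoint (emb (lunit (sval X))))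
  (fun X : full_ob B => dpoint (emb (runit (sval X))))
  (fun X Y : full_ob B => dpoint (emb (msw (sval X) (sval Y))))).
- split=> [X Y Z|X]; first exact: cprod_comp.
  exact: cprod_unit.
- split=> [X Y|X]; first exact: cprod_massoc.
  exists (dpoint (emb (massoc' _ _ _))); exact/corr_cat_iso/massocK.
- split=> [X Y|X]; first exact: cprod_lunit.
  exists (dpoint (emb (lunit' _))); exact/corr_cat_iso/lunitK.
- split=> [X Y|X]; first exact: cprod_runit.
  exists (dpoint (emb (runit' _))); exact/corr_cat_iso/runitK.
- split=> [X Y|X]; first exact: cprod_msw.
  exists (dpoint (emb (msw _ _))); exact/corr_cat_iso/mswK.
- by move=> X Y; rewrite ucompE msw_inv.
- move=> X Y; rewrite !vidE !(uprodE, ucompE).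
  exact: (congr1 (fun h => dpoint (emb h)) (triangle _ _)).
- move=> X Y Z W; rewrite !vidE !(uprodE, ucompE).
  exact: (congr1 (fun h => dpoint (emb h)) (pentagon _ _ _ _)).
- move=> X Y Z; rewrite !vidE !(uprodE, ucompE).
  exact: (congr1 (fun h => dpoint (emb h)) (hexagon _ _ _)).
Qed.
End SymMon.

End Enriched.

Theorem theorem2p4 (C : SymMonCat) (O : ZeroObject C)
    (C_colimits : has_finite_colimits C) (C_distr : tens_distributive C)
    (P : C) (E : RingObject C)
    (B : C -> Prop) (B_prod : forall X Y : C, B X -> B Y -> B (X ⊗ Y)) :
  exists (hact : corr_is_symseq O P E B)
    (comp : forall X Y Z : full_ob B,
       Hom (corr_hom hact X Y ⊗ corr_hom hact Y Z) (corr_hom hact X Z))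
    (one : forall X : full_ob B, Hom munit (corr_hom hact X X)),
    [/\ comp_is_corr_mul comp,
        one_is_corr_one one,
        is_vcat (corr_vcat comp one)
      & ring_commutative E -> forall B_unit : B munit,
          inhabited (@SymMonVCat SymPSetMon (corr_vcat comp one)
            (sub_prod B_prod) (exist B munit B_unit))].
Proof.
exists (fun X Y : full_ob B => corr_laws O P E (sval X) (sval Y)).
exists (fun X Y Z : full_ob B => ccomp O P E C_distr (sval X) (sval Y) (sval Z)).
exists (fun X : full_ob B => dpoint (cemb O P E (idm (sval X)))).
split=> [X Y Z n m f g|X||comm B_unit].
- by rewrite day_elimE sact1 scast_id.
- by [].
- exact: corr_cat_is_vcat.
- exact: corr_cat_symmon.
Qed.
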